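(* (HELP: homotopy extension and lifting property.) Let $M$ be a monoid, let $n\in\mathbb N\cup\{\infty\}$, let $(X,A)$ be a projective relative $M$-CW complex of dimension at most $n$ with inclusion $i\colon A\to X$, and let $k\colon Y\to Z$ be an $M$-equivariant $n$-equivalence of $M$-spaces. Suppose given $M$-equivariant continuous mappings $f\colon X\to Z$, $g\colon A\to Y$ and $h\colon A\times I\to Z$ such that $k\circ g=h\circ i_1$ and $f\circ i=h\circ i_0$. Then there exist $M$-equivariant continuous mappings $\widetilde g\colon X\to Y$ and $\widetilde h\colon X\times I\to Z$ such that $\widetilde g\circ i=g$, $\widetilde h\circ(i\times 1_I)=h$, $\widetilde h\circ i_0=f$ and $\widetilde h\circ i_1=k\circ\widetilde g$.
   Context: Let $M$ be a monoid with the discrete topology. A left $M$-set is a set with an action satisfying $1x=x$, $m(nx)=(mn)x$. An $M$-set $P$ is projective if every surjective $M$-equivariant map onto $P$ has an $M$-equivariant section; equivalently $P\cong\coprod_{a\in A}Me_a$ with each $e_a\in M$ idempotent. An $M$-space is a topological space with a continuous left action $M\times X\to X$; $M$-sets are regarded as discrete $M$-spaces. $I=[0,1]$, the ball $B^n$ and the sphere $S^{n-1}=\partial B^n$ carry trivial $M$-actions, and products carry the diagonal action. A projective relative $M$-CW complex is a pair $(X,A)$ of $M$-spaces with $X=\varinjlim X_n$ (along inclusions $X_n\to X_{n+1}$), $X_{-1}=A$, $X_0=P_0\sqcup A$ with $P_0$ a projective $M$-set, and such that for $n\ge1$ the space $X_n$ is a pushout of $M$-spaces $X_n=X_{n-1}\cup_{P_n\times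 S^{n-1}}(P_n\times B^n)$ along an $M$-equivariant continuous map $P_n\times S^{n-1}\to X_{n-1}$, with $P_n$ a projective $M$-set. It has dimension at most $n$ if $P_k=\emptyset$ for all $k>n$ (no condition if $n=\infty$). A continuous map $f\colon X\to Y$ is an $n$-equivalence if $f_*\colon\pi_q(X,x)\to\pi_q(Y,f(x))$ is a bijection for $0\le q<n$ and a surjection for $q=n$, for all base points $x$ (with $\pi_0$ the set of path components). An $\infty$-equivalence is a weak equivalence, i.e. $f_*$ is a bijection for all $q\ge0$. For a space $W$ and $j=0,1$, $i_j\colon W\to W\times I$ is $i_j(w)=(w,j)$. *)

(* Defs.v *)
From HB Require Import structures.
From mathcomp Require Import all_boot all_order all_algebra generic_quotient.
From mathcomp Require Import all_classical all_reals topology normedtype.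

Set Implicit Arguments.
Unset Strict Implicit.
Unset Printing Implicit Defensive.

Import Order.TTheory GRing.Theory Num.Theory.
Import numFieldNormedType.Exports.

Local Open Scope classical_set_scope.
Local Open Scope ring_scope.
Local Open Scope quotient_scope.

Lemma fst_cts (S T : topologicalType) : continuous (@fst S T).
Proof. by move=> [x y]; exact: cvg_fst. Qed.

Lemma snd_cts (S T : topologicalType) : continuous (@snd S T).
Proof. by move=> [x y]; exact: cvg_snd. Qed.

Lemma comp_cts (S T U : topologicalType) (f : S -> T) (g : T -> U) :
  continuous f -> continuous g -> continuous (g \o f).
Proof. by move=> cf cg x; exact: (continuous_comp (cf x) (cg (f x))). Qed.

Lemma pair_cts (S T U : topologicalType) (f : S -> T) (g : S -> U) :
  continuous f -> continuous g -> continuous (fun x => (f x, g x)).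
Proof.
move=> cf cg x.
exact: (@cvg_pair S T U (nbhs x) (nbhs (f x)) (nbhs (g x)) _ _ _ f g
  (cf x) (cg x)).
Qed.

HB.mixin Record isMSet (M : monoidType) X of Choice X := {
  mact : M -> X -> X;
  mact1 : forall x, mact 1%g x = x;
  mactM : forall m n x, mact (m * n)%g x = mact m (mact n x)
}.

#[short(type="mSetType")]
HB.structure Definition MSet (M : monoidType) := {X of isMSet M X & Choice X}.

HB.mixin Record isMSpace (M : monoidType) X of Topological X & isMSet M X := {
  mact_continuous :
    continuous (fun mx : discrete_topology M * X => mact (mx.1 : M) mx.2)
}.

#[short(type="mSpaceType")]
HB.structure Definition MSpace (M : monoidType) :=
  {X of isMSpace M X & MSet M X & Topological X}.

Definition equivariant (M : monoidType) (X Y : mSetType M) (f : X -> Y) :=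
  forall (m : M) (x : X), f (mact m x) = mact m (f x).

HB.mixin Record isEquivariant (M : monoidType) (X Y : mSetType M)
  (f : X -> Y) := { mmapP : equivariant f }.

#[short(type="mMapType")]
HB.structure Definition MMap (M : monoidType) (X Y : mSpaceType M) :=
  {f of isEquivariant M X Y f & @isContinuous X Y f}.

Section discrete_mspace.
Context (M : monoidType) (P : mSetType M).

HB.instance Definition _ := isMSet.Build M (discrete_topology P)
  (@mact1 M P) (@mactM M P).

Lemma discrete_mact_continuous : continuous
  (fun mx : discrete_topology M * discrete_topology P =>
     (mact (mx.1 : M) mx.2 : discrete_topology P)).
Proof.
move=> [m x] U /= /nbhs_singleton Ux.
exists ([set m], [set x]) => /=; first by split; exact: discrete_set1.
by move=> [_ _] [/= -> ->].
Qed.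

HB.instance Definition _ :=
  isMSpace.Build M (discrete_topology P) discrete_mact_continuous.

End discrete_mspace.

Definition trivial_mspace (M : monoidType) (T : Type) : Type := T.

Section trivial_mspace.
Context (M : monoidType) (T : topologicalType).

HB.instance Definition _ := Topological.copy (trivial_mspace M T) T.
HB.instance Definition _ := isMSet.Build M (trivial_mspace M T)
  (mact := fun _ x => x) (fun=> erefl) (fun _ _ _ => erefl).

Lemma trivial_mact_continuous : continuous
  (fun mx : discrete_topology M * trivial_mspace M T =>
     mact (mx.1 : M) mx.2).
Proof. exact: snd_cts. Qed.

HB.instance Definition _ :=
  isMSpace.Build M (trivial_mspace M T) trivial_mact_continuous.

End trivial_mspace.

Section prod_mspace.
Context (M : monoidType) (X Y : mSpaceType M).

Definition prod_mact (m : M) (xy : X * Y) : X * Y :=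
  (mact m xy.1, mact m xy.2).

Lemma prod_mact1 xy : prod_mact 1%g xy = xy.
Proof. by case: xy => x y; rewrite /prod_mact !mact1. Qed.

Lemma prod_mactM m n xy :
  prod_mact (m * n)%g xy = prod_mact m (prod_mact n xy).
Proof. by rewrite /prod_mact !mactM. Qed.

HB.instance Definition _ :=
  isMSet.Build M (X * Y)%type prod_mact1 prod_mactM.

Lemma prod_mact_continuous : continuous
  (fun mxy : discrete_topology M * (X * Y) => mact (mxy.1 : M) mxy.2).
Proof.
pose dM := discrete_topology M.
pose p1 (q : dM * (X * Y)) := (q.1, q.2.1).
pose p2 (q : dM * (X * Y)) := (q.1, q.2.2).
have s1 := comp_cts (@snd_cts dM (X * Y)%type) (@fst_cts X Y).
have s2 := comp_cts (@snd_cts dM (X * Y)%type) (@snd_cts X Y).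
have p1c : continuous p1 := pair_cts (@fst_cts _ _) s1.
have p2c : continuous p2 := pair_cts (@fst_cts _ _) s2.
exact: (pair_cts (comp_cts p1c (@mact_continuous M X))
                 (comp_cts p2c (@mact_continuous M Y))).
Qed.

HB.instance Definition _ :=
  isMSpace.Build M (X * Y)%type prod_mact_continuous.

End prod_mspace.

Section euclidean.
Context (R : realType).

Definition unitI : topologicalType := [set t : R | 0 <= t <= 1].

Lemma unitI0_subproof : (0 : R) \in [set t : R | 0 <= t <= 1].
Proof. by rewrite inE /= lexx ler01. Qed.
Lemma unitI1_subproof : (1 : R) \in [set t : R | 0 <= t <= 1].
Proof. by rewrite inE /= lexx ler01. Qed.

Definition unitI0 : unitI := exist _ 0 unitI0_subproof.
Definition unitI1 : unitI := exist _ 1 unitI1_subproof.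

Definition sqnorm n (v : 'rV[R]_n) : R := \sum_(i < n) v 0 i ^+ 2.

(* B^n and its boundary S^(n-1), both in R^n: the index of [unit_sphere] is the
   dimension of the ambient space. *)
Definition unit_ball n : topologicalType := [set v : 'rV[R]_n | sqnorm v <= 1].
Definition unit_sphere n : topologicalType := [set v : 'rV[R]_n | sqnorm v = 1].

Lemma sphere_ball_subproof n (v : unit_sphere n) :
  \val v \in [set v : 'rV[R]_n | sqnorm v <= 1].
Proof. by case: v => v /= /set_mem /= v1; rewrite inE /= v1. Qed.

Definition sphere_ball n (v : unit_sphere n) : unit_ball n :=
  exist _ (\val v) (sphere_ball_subproof v).

Lemma sphere_ball_continuous n : continuous (@sphere_ball n).
Proof.
apply: (@continuous_comp_initial _ _ _ set_val (@sphere_ball n)) => v.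
exact: initial_continuous.
Qed.

Lemma sphere_base_subproof q : sqnorm (delta_mx 0 0 : 'rV[R]_q.+1) = 1.
Proof.
rewrite /sqnorm (bigD1 ord0) //= mxE eqxx expr1n big1 ?addr0// => i i0.
by rewrite mxE (negPf i0) andbF expr0n.
Qed.

Definition sphere_base q : unit_sphere q.+1 :=
  exist _ (delta_mx 0 0) (mem_set (sphere_base_subproof q)).

End euclidean.

Section cylinder.
Context (R : realType) (M : monoidType) (X : mSpaceType M).

Definition cylinder : mSpaceType M := (X * trivial_mspace M (unitI R))%type.

Definition cyl_in0 (x : X) : cylinder := (x, unitI0 R).
Definition cyl_in1 (x : X) : cylinder := (x, unitI1 R).

End cylinder.
Arguments cyl_in0 R {M X} x.
Arguments cyl_in1 R {M X} x.

(* i x 1_I *)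
Definition cylinder_map (R : realType) (M : monoidType) (X Y : mSpaceType M)
    (i : X -> Y) (xt : cylinder R X) : cylinder R Y := (i xt.1, xt.2).
Arguments cylinder_map R {M X Y} i xt.

Section cells.
Context (R : realType) (M : monoidType) (P : mSetType M) (n : nat).

Definition ball_cells : mSpaceType M :=
  (discrete_topology P * trivial_mspace M (unit_ball R n))%type.
Definition sphere_cells : mSpaceType M :=
  (discrete_topology P * trivial_mspace M (unit_sphere R n))%type.

Definition cells_boundary (c : sphere_cells) : ball_cells :=
  (c.1, sphere_ball c.2).

Lemma cells_boundary_continuous : continuous cells_boundary.
Proof.
exact: (pair_cts (@fst_cts (discrete_topology P) (unit_sphere R n))
  (comp_cts (@snd_cts (discrete_topology P) (unit_sphere R n))
            (@sphere_ball_continuous R n))).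
Qed.

Lemma cells_boundary_equivariant : equivariant cells_boundary.
Proof. by []. Qed.

HB.instance Definition _ :=
  @isContinuous.Build _ _ cells_boundary cells_boundary_continuous.
HB.instance Definition _ :=
  @isEquivariant.Build M _ _ cells_boundary cells_boundary_equivariant.

End cells.

Definition projective (M : monoidType) (P : mSetType M) :=
  forall (Q : mSetType M) (p : Q -> P), equivariant p ->
    (forall x, exists y, p y = x) ->
    exists2 s : P -> Q, equivariant s & cancel s p.

Section colimits.
Context (M : monoidType).
Implicit Types U V W X Y Z : mSpaceType M.

Definition is_coproduct X Y Z (a : mMapType X Z) (b : mMapType Y Z) :=
  forall W (u : mMapType X W) (v : mMapType Y W),
    (exists w : mMapType Z W, w \o a =1 u /\ w \o b =1 v) /\
    (forall w w' : mMapType Z W,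
      w \o a =1 w' \o a -> w \o b =1 w' \o b -> w =1 w').

(*  U --b--> Y
    a|       |d
     v       v
     X --c--> Z  *)
Definition is_pushout U X Y Z (a : mMapType U X) (b : mMapType U Y)
    (c : mMapType X Z) (d : mMapType Y Z) :=
  c \o a =1 d \o b /\
  forall W (u : mMapType X W) (v : mMapType Y W), u \o a =1 v \o b ->
    (exists w : mMapType Z W, w \o c =1 u /\ w \o d =1 v) /\
    (forall w w' : mMapType Z W,
      w \o c =1 w' \o c -> w \o d =1 w' \o d -> w =1 w').

Definition is_sequential_colimit (X_ : nat -> mSpaceType M)
    (j : forall n, mMapType (X_ n) (X_ n.+1)) X
    (c : forall n, mMapType (X_ n) X) :=
  (forall n, c n.+1 \o j n =1 c n) /\
  forall W (u : forall n, mMapType (X_ n) W),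
    (forall n, u n.+1 \o j n =1 u n) ->
    (exists w : mMapType X W, forall n, w \o c n =1 u n) /\
    (forall w w' : mMapType X W,
      (forall n, w \o c n =1 w' \o c n) -> w =1 w').

End colimits.

(* A cell structure on the pair (X, A), [i] being the inclusion of A in X;
   [cw_X n] is X_n and [cw_cells n] is P_n. That [cw_incl n], [cw_skel n],
   [cw_base] and [i] are (closed) embeddings follows from the universal
   properties, so that the X_n are, up to isomorphism, subspaces of X. *)
Record projective_relative_CW (R : realType) (M : monoidType)
    (A X : mSpaceType M) (i : mMapType A X) := ProjectiveRelativeCW {
  cw_cells : nat -> mSetType M;
  cw_projective : forall n, projective (cw_cells n);
  cw_X : nat -> mSpaceType M;
  cw_vertices : mMapType (discrete_topology (cw_cells 0)) (cw_X 0);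
  cw_base : mMapType A (cw_X 0);
  cw_X0 : is_coproduct cw_vertices cw_base;
  cw_incl : forall n, mMapType (cw_X n) (cw_X n.+1);
  cw_attach : forall n, mMapType (sphere_cells R (cw_cells n.+1) n.+1) (cw_X n);
  cw_char : forall n,
    mMapType (ball_cells R (cw_cells n.+1) n.+1) (cw_X n.+1);
  cw_XS : forall n, is_pushout (cw_attach n)
    (@cells_boundary R M (cw_cells n.+1) n.+1) (cw_incl n) (cw_char n);
  cw_skel : forall n, mMapType (cw_X n) X;
  cw_colimit : is_sequential_colimit cw_incl cw_skel;
  cw_inclusion : cw_skel 0 \o cw_base =1 i
}.

(* Dimensions in N u {oo} are of type [option nat], [None] standing for oo. *)
Definition dim_le (R : realType) (M : monoidType) (A X : mSpaceType M)
    (i : mMapType A X) (C : projective_relative_CW R i) (n : option nat) :=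
  if n is Some m then forall k, (m < k)%N -> [set: cw_cells C k] = set0
  else True.

Section homotopy.
Context (R : realType).
Local Notation I := (unitI R).

Definition homotopic (W X : topologicalType) (D : set W) (f g : W -> X) :=
  exists H : W * I -> X, [/\ continuous H,
    forall w, H (w, unitI0 R) = f w,
    forall w, H (w, unitI1 R) = g w &
    forall w t, D w -> H (w, t) = f w].

Definition path_joined (X : topologicalType) (x y : X) :=
  exists gamma : I -> X,
    [/\ continuous gamma, gamma (unitI0 R) = x & gamma (unitI1 R) = y].

Lemma clamp_subproof (t : R) :
  Num.max 0 (Num.min t 1) \in [set t : R | 0 <= t <= 1].
Proof.
by rewrite inE /= le_max lexx /= ge_max ler01 ge_min lexx orbT.
Qed.

Definition clamp (t : R) : I :=
  exist _ (Num.max 0 (Num.min t 1)) (clamp_subproof t).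

Lemma clamp_continuous : continuous clamp.
Proof.
apply: (@continuous_comp_initial _ _ _ set_val clamp) => t.
have c0 : {for t, continuous (cst (0 : R) : R -> R^o)} by exact: cvg_cst.
have c1 : {for t, continuous (cst (1 : R) : R -> R^o)} by exact: cvg_cst.
have ct : {for t, continuous (id : R -> R^o)} by exact: cvg_id.
exact: (continuous_max c0 (continuous_min ct c1)).
Qed.

Lemma clampK (t : R) : 0 <= t <= 1 -> \val (clamp t) = t.
Proof. by case/andP => t0 t1 /=; rewrite (min_idPl t1) (max_idPr t0). Qed.

Lemma unitI_ge0_le1 (t : I) : 0 <= \val t <= 1.
Proof. by case: t => t /= /set_mem. Qed.

Lemma clamp0 (t : R) : t <= 0 -> clamp t = unitI0 R.
Proof.
move=> t0; apply: val_inj => /=.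
by rewrite (min_idPl (le_trans t0 ler01)) (max_idPl t0).
Qed.

Lemma clamp1 (t : R) : 1 <= t -> clamp t = unitI1 R.
Proof.
by move=> t1; apply: val_inj => /=; rewrite (min_idPr t1) (max_idPr ler01).
Qed.

Lemma val_cts : continuous (fun t : I => \val t : R).
Proof. exact: initial_continuous. Qed.

Lemma reparam_cts (W X : topologicalType) (H : W * I -> X) (a b : R) :
  continuous H ->
  continuous (fun wt : W * I => H (wt.1, clamp (a * \val wt.2 + b))).
Proof.
move=> cH.
have v : continuous (fun wt : W * I => \val wt.2 : R).
  exact: comp_cts (@snd_cts W I) val_cts.
have aff : continuous (fun r : R => a * r + b : R).
  move=> r; apply: (@cvgD R R^o); last exact: cvg_cst.
  by apply: (@cvgM R); [exact: cvg_cst|exact: cvg_id].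
have c := comp_cts (comp_cts v aff) clamp_continuous.
exact: (comp_cts (pair_cts (@fst_cts W I) c) cH).
Qed.

Lemma homotopic_refl (W X : topologicalType) (D : set W) (f : W -> X) :
  continuous f -> homotopic D f f.
Proof.
move=> cf; exists (f \o fst); split => //.
exact: comp_cts (@fst_cts W I) cf.
Qed.

Lemma homotopic_sym (W X : topologicalType) (D : set W) (f g : W -> X) :
  homotopic D f g -> homotopic D g f.
Proof.
move=> [H [cH H0 H1 HD]].
exists (fun wt : W * I => H (wt.1, clamp (-1 * \val wt.2 + 1))); split.
- exact: reparam_cts.
- by move=> w /=; rewrite clamp1 ?mulr0 ?add0r.
- by move=> w /=; rewrite clamp0 ?mulr1 ?addNr.
- by move=> w t Dw /=; rewrite -H1 !HD.
Qed.

Lemma homotopic_trans (W X : topologicalType) (D : set W) (f g h : W -> X) :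
  homotopic D f g -> homotopic D g h -> homotopic D f h.
Proof.
move=> [H [cH H0 H1 HD]] [K [cK K0 K1 KD]].
pose F (wt : W * I) := H (wt.1, clamp (2 * \val wt.2 + 0)).
pose G (wt : W * I) := K (wt.1, clamp (2 * \val wt.2 + - 1)).
pose A := [set wt : W * I | \val wt.2 <= 2^-1 :> R].
pose B := [set wt : W * I | 2^-1 <= \val wt.2 :> R].
pose FG wt := if \val wt.2 <= 2^-1 :> R then F wt else G wt.
have v : continuous (fun wt : W * I => \val wt.2 : R).
  exact: comp_cts (@snd_cts W I) val_cts.
have FA wt : A wt -> FG wt = F wt by rewrite /A /FG /= => ->.
have GB wt : B wt -> FG wt = G wt.
  rewrite /B /FG /=; case: ifPn => // vA vB.
  have /eqP vE : \val wt.2 == 2^-1 :> R by rewrite eq_le vA vB.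
  rewrite /F /G vE addr0 divff ?pnatr_eq0// subrr.
  by rewrite clamp1// clamp0// H1 K0.
have vP := (@continuous_closedP (W * I)%type R _).1 v.
have cA : closed A := vP _ (@closed_le R 2^-1).
have cB : closed B := vP _ (@closed_ge R 2^-1).
exists FG; split.
- have AB : A `|` B = setT.
    by apply/seteqP; split => // wt _; rewrite /A /B /=; exact/orP/le_total.
  apply/continuous_subspace_setT; rewrite -AB; apply: withinU_continuous => //.
    apply: (@subspace_eq_continuous _ _ _ F).
      by move=> wt /set_mem /FA.
    exact/continuous_subspaceT/reparam_cts.
  apply: (@subspace_eq_continuous _ _ _ G).
    by move=> wt /set_mem /GB.
  exact/continuous_subspaceT/reparam_cts.
- move=> w; rewrite FA /A /F /= ?invr_ge0 ?ler0n//.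
  by rewrite clamp0 ?mulr0 ?addr0.
- move=> w; rewrite GB /B /G /= ?invf_le1 ?ler1n ?ltr0n//.
  by rewrite clamp1// mulr1 lerBrDr.
- move=> w t Dw; rewrite /FG; case: ifP => _; first by rewrite /F HD.
  by rewrite /G KD// -H1 HD.
Qed.

Lemma path_homotopic (X : topologicalType) (x y : X) :
  path_joined x y <-> homotopic set0 (cst x : I -> X) (cst y).
Proof.
split=> [[p [cp <- <-]]|[H [cH H0 H1 _]]].
  by exists (p \o snd); split => //; exact: comp_cts (@snd_cts _ _) cp.
exists (fun t => H (unitI0 R, t)); split; [|by rewrite H0|by rewrite H1].
have c0 : continuous (cst (unitI0 R) : I -> I).
  by move=> t; exact: cst_continuous.
have cid : continuous (id : I -> I) by move=> t; exact: cvg_id.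
exact: (comp_cts (pair_cts c0 cid) cH).
Qed.

Lemma path_joined_comp (X Y : topologicalType) (f : continuousType X Y) x y :
  path_joined x y -> path_joined (f x) (f y).
Proof.
move=> [p [cp <- <-]]; exists (f \o p); split => //.
exact: comp_cts cp (@cts_fun _ _ f).
Qed.

Section pi0.
Context (X : topologicalType).

Let joined (x y : X) : bool := `[< path_joined x y >].

Lemma joined_refl : reflexive joined.
Proof.
by move=> x; apply/asboolP/path_homotopic/homotopic_refl/cst_continuous.
Qed.

Lemma joined_sym : symmetric joined.
Proof.
move=> x y; apply/asbool_equiv_eq; split => /path_homotopic h;
  exact/path_homotopic/homotopic_sym.
Qed.

Lemma joined_trans : transitive joined.
Proof.
move=> y x z /asboolP/path_homotopic xy /asboolP/path_homotopic yz.
exact/asboolP/path_homotopic/(homotopic_trans xy).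
Qed.

Definition pi0_rel := EquivRel joined joined_refl joined_sym joined_trans.
Definition pi0 : Type := {eq_quot pi0_rel}.
Definition pi0_class (x : X) : pi0 := \pi_{eq_quot pi0_rel} x.

Lemma pi0_classP x y : pi0_class x = pi0_class y <-> path_joined x y.
Proof.
by rewrite /pi0_class; split => [/eqmodP/asboolP//|h]; exact/eqmodP/asboolP.
Qed.

End pi0.

Definition pi0_map (X Y : topologicalType) (f : continuousType X Y)
    (c : pi0 X) : pi0 Y :=
  pi0_class (f (repr (c : {eq_quot pi0_rel X}))).

Lemma pi0_mapE (X Y : topologicalType) (f : continuousType X Y) x :
  pi0_map f (pi0_class x) = pi0_class (f x).
Proof.
by apply/pi0_classP/path_joined_comp/pi0_classP; rewrite /pi0_class reprK.
Qed.

Definition based_maps (q : nat) (X : topologicalType) (x : X) :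
    set (unit_sphere R q.+1 -> X) :=
  [set a | continuous a /\ a (sphere_base R q) = x].
Arguments based_maps q {X} x.

Section pi.
Context (q : nat) (X : topologicalType) (x : X).

Let based_homotopic (a b : based_maps q x) : bool :=
  `[< homotopic [set sphere_base R q] (\val a) (\val b) >].

Lemma based_homotopic_refl : reflexive based_homotopic.
Proof.
by case=> a /= /[dup] /set_mem [ca _] aP; exact/asboolP/homotopic_refl.
Qed.

Lemma based_homotopic_sym : symmetric based_homotopic.
Proof. by move=> a b; apply/asbool_equiv_eq; split; exact: homotopic_sym. Qed.

Lemma based_homotopic_trans : transitive based_homotopic.
Proof.
by move=> b a c /asboolP ab /asboolP bc; exact/asboolP/(homotopic_trans ab).
Qed.

Definition hpi_rel := EquivRel based_homotopic
  based_homotopic_refl based_homotopic_sym based_homotopic_trans.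
(* The underlying set of the homotopy group pi_q(X, x). *)
Definition hpi : Type := {eq_quot hpi_rel}.
Definition hpi_class (a : based_maps q x) : hpi := \pi_{eq_quot hpi_rel} a.

Lemma hpi_classP a b : hpi_class a = hpi_class b <->
  homotopic [set sphere_base R q] (\val a) (\val b).
Proof.
by rewrite /hpi_class; split => [/eqmodP/asboolP//|h]; exact/eqmodP/asboolP.
Qed.

End pi.

Lemma based_comp_subproof q (X Y : topologicalType) (f : continuousType X Y)
    (x : X) (a : based_maps q x) : f \o \val a \in based_maps q (f x).
Proof.
case: a => a /= /set_mem [ca ax]; rewrite inE; split.
  exact: comp_cts ca (@cts_fun _ _ f).
by rewrite /= ax.
Qed.

Definition based_comp q (X Y : topologicalType) (f : continuousType X Y)
    (x : X) (a : based_maps q x) : based_maps q (f x) :=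
  exist _ (f \o \val a) (based_comp_subproof f a).

Definition hpi_map q (X Y : topologicalType) (f : continuousType X Y)
    (x : X) (c : hpi q x) : hpi q (f x) :=
  hpi_class (based_comp f (repr (c : {eq_quot hpi_rel q x}))).

Lemma hpi_mapE q (X Y : topologicalType) (f : continuousType X Y)
    (x : X) (a : based_maps q x) :
  hpi_map f (hpi_class a) = hpi_class (based_comp f a).
Proof.
rewrite /hpi_map; apply/hpi_classP => /=; set b := repr _.
have /hpi_classP [H [cH H0 H1 HD]] : hpi_class b = hpi_class a.
  by rewrite /b /hpi_class reprK.
exists (f \o H); split => [|w|w|w t Dw] /=.
- exact: comp_cts cH (@cts_fun _ _ f).
- by rewrite H0.
- by rewrite H1.
- by rewrite HD.
Qed.

Definition surjective (S T : Type) (u : S -> T) := forall y, exists x, u x = y.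

(* For q = 0 the condition is on the sets of path components, without base
   point: quantified over the points of X, it would be vacuous for empty X, and
   every map from the empty space would be an n-equivalence. *)
Definition pi_bijective (X Y : topologicalType) (f : continuousType X Y) q :=
  if q is 0 then bijective (pi0_map f)
  else forall x : X, bijective (@hpi_map q X Y f x).

Definition pi_surjective (X Y : topologicalType) (f : continuousType X Y) q :=
  if q is 0 then surjective (pi0_map f)
  else forall x : X, surjective (@hpi_map q X Y f x).

Definition n_equivalence (n : option nat) (X Y : topologicalType)
    (f : continuousType X Y) :=
  if n is Some m
  then (forall q, (q < m)%N -> pi_bijective f q) /\ pi_surjective f m
  else forall q, pi_bijective f q.

End homotopy.

(* Main.v *)
Require Import Defs.
From HB Require Import structures.
From mathcomp Require Import all_boot all_order all_algebra.
From mathcomp Require Import all_classical all_reals topology normedtype.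
From mathcomp Require Import realfun ring lra.

(** Let E be the mapping path space of k, that is the space of pairs of a point
    y of Y and a path in Z ending at k y, with the compact-open topology on
    paths, and let p : E -> Z send such a pair to the start of its path. As the
    unit interval is locally compact and regular, a map A -> E is the same as a
    map g : A -> Y together with a homotopy h : A * I -> Z ending at k \o g; so
    the theorem says exactly that p has the lifting property with respect to
    A -> X.

    A lifting property passes through coproducts, pushouts and sequential
    colimits ([relative_CW_lift]), which leaves the vertices and the inclusions
    of P * S^(n-1) in P * B^n. A section of M * P -> P expresses each x in a
    projective P as c(x) b(x), where c is equivariant and b is invariant
    ([projective_coord]); given any lifts l_x over the individual cells, the
    formula (x, v) |-> c(x) l_(b(x))(v) is then an equivariant lift. The
    monoid has thus disappeared, and what is left is to lift over one ball
    B^(q+1), given a lift e on its boundary S^q ([ball_lift]).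

    Let e = (g, h) on S^q and f : B^(q+1) -> Z be given. Attaching the homotopy
    h to f as a collar gives f1 : B^(q+1) -> Z with boundary value k \o g.
    Injectivity of k on pi_q extends g to a map G on the ball. The maps f1 on
    the lower and k \o G on the upper hemisphere form a map S^(q+1) -> Z which,
    by surjectivity of k on pi_(q+1), is homotopic to k \o a for some a, that
    is, it lifts to E. The restriction of this lift to the lower hemisphere
    lifts f1, but its boundary value is that of the upper half, not (g, const).
    The upper half and (G, const) are however two lifts of the same map on a
    contractible space that agree at the base point, hence they are homotopic
    over Z ([fibre_homotopy]); and a lift can be altered by any homotopy over Z
    of its boundary values ([boundary_slide]). This lifts f1 with boundary value
    (g, const); dragging the lift from f1 back to f gives boundary value h
    followed by a constant path, and a reparametrisation, again a homotopy
    over Z, turns it into h.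

    The last three steps use a single property of p: a point of E over the end
    of a path in Z can be pulled back over the start of that path, continuously,
    and with no change when the path takes no time ([path_transport]). *)

Set Implicit Arguments.
Unset Strict Implicit.
Unset Printing Implicit Defensive.

Import Order.TTheory GRing.Theory Num.Theory.
Import numFieldNormedType.Exports.

Local Open Scope classical_set_scope.
Local Open Scope ring_scope.

(** * Continuity of glued and of vector-valued maps *)

Section gluing.
Context (R : realType) (T U : topologicalType).

(** Continuity is required pointwise and on one side only, because radial
    formulas such as v |-> v / |v| are continuous only away from the origin. *)
Lemma glue_cts (u : T -> R) (c : R) (F G : T -> U) : continuous u ->
  (forall x, u x <= c -> {for x, continuous F}) ->
  (forall x, c <= u x -> {for x, continuous G}) ->
  (forall x, u x = c -> F x = G x) ->
  continuous (fun x => if u x <= c then F x else G x).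
Proof.
move=> uc Fc Gc FG; set FG' := fun x => _.
pose A := [set x : T | u x <= c]; pose B := [set x : T | c <= u x].
have FA x : A x -> FG' x = F x by rewrite /A /FG' /= => ->.
have GB x : B x -> FG' x = G x.
  rewrite /B /FG' /=; case: ifPn => // vA vB.
  by apply: FG; apply/eqP; rewrite eq_le vA vB.
have vP := (@continuous_closedP T R _).1 uc.
have cA : closed A := vP _ (@closed_le R c).
have cB : closed B := vP _ (@closed_ge R c).
have AB : A `|` B = setT.
  by apply/seteqP; split => // x _; rewrite /A /B /=; exact/orP/le_total.
apply/continuous_subspace_setT; rewrite -AB; apply: withinU_continuous => //.
  apply: (@subspace_eq_continuous _ _ _ F).
    by move=> x /set_mem /FA.
  by apply: continuous_in_subspaceT => x /set_mem; exact: Fc.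
apply: (@subspace_eq_continuous _ _ _ G).
  by move=> x /set_mem /GB.
by apply: continuous_in_subspaceT => x /set_mem; exact: Gc.
Qed.

End gluing.

Section discrete_domain.
Context (P : choiceType) (W : topologicalType).

Lemma discrete_cts (F : discrete_topology P -> W) : continuous F.
Proof.
move=> x U /= /nbhs_singleton Ux.
by apply: (@filterS _ _ (nbhs_filter x) _ _ _ (discrete_set1 x)) => y ->.
Qed.

Lemma discrete_prod_cts (T : topologicalType)
    (F : discrete_topology P * T -> W) :
  (forall x, continuous (fun t => F (x, t))) -> continuous F.
Proof.
move=> cF [x t] U /(cF x t) /= Ut.
exists ([set x], fun t => U (F (x, t))).
  by split => //; exact: discrete_set1.
by move=> [y s] [/= -> ].
Qed.

End discrete_domain.

Section real_continuity.
Context (R : realType) (T : topologicalType).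
Implicit Types (f g : T -> R).

Lemma cst_cts (U : topologicalType) (c : U) : continuous (fun _ : T => c).
Proof. by move=> x; exact: cvg_cst. Qed.

Lemma add_cts f g : continuous f -> continuous g ->
  continuous (fun x => f x + g x).
Proof. by move=> cf cg x; exact: (@cvgD R R^o _ _ _ f g _ _ (cf x) (cg x)). Qed.

Lemma mul_cts f g : continuous f -> continuous g ->
  continuous (fun x => f x * g x).
Proof. by move=> cf cg x; exact: (@cvgM R _ _ _ f g _ _ (cf x) (cg x)). Qed.

Lemma opp_cts f : continuous f -> continuous (fun x => - f x).
Proof. by move=> cf x; exact: (@cvgN R R^o _ _ _ f _ (cf x)). Qed.

Lemma max_cts f g : continuous f -> continuous g ->
  continuous (fun x => Num.max (f x) (g x)).
Proof. by move=> cf cg x; exact: (continuous_max (cf x) (cg x)). Qed.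

Lemma min_cts f g : continuous f -> continuous g ->
  continuous (fun x => Num.min (f x) (g x)).
Proof. by move=> cf cg x; exact: (continuous_min (cf x) (cg x)). Qed.

Lemma inv_cts f : (forall x, f x != 0) -> continuous f ->
  continuous (fun x => (f x)^-1).
Proof. by move=> f0 cf x; exact: (cvgV (f0 x) (cf x)). Qed.

Lemma scale_cts n (c : T -> R) (v : T -> 'rV[R]_n) :
  continuous c -> continuous v -> continuous (fun x => c x *: v x).
Proof. by move=> cc cv x; exact: (cvgZ (cc x) (cv x)). Qed.

Lemma addv_cts n (v w : T -> 'rV[R]_n) :
  continuous v -> continuous w -> continuous (fun x => v x + w x).
Proof. by move=> cv cw x; exact: (cvgD (cv x) (cw x)). Qed.

Lemma rV_cts n (v : T -> 'rV[R]_n) :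
  (forall j, continuous (fun x => v x 0 j)) -> continuous v.
Proof.
move=> cv.
have -> : v = fun x => \sum_j (v x 0 j) *: delta_mx 0 j.
  by apply/funext => x; exact: row_sum_delta.
have c0 : continuous (fun xy : 'rV[R]_n * 'rV[R]_n => xy.1 + xy.2).
  by move=> x; apply: cvgD; [exact: cvg_fst | exact: cvg_snd].
have := @continuous_big 'rV[R]_n 'I_n +%R 0 xpredT c0 T (index_enum _)
  (fun j x => (v x 0 j) *: delta_mx 0 j).
apply => i _; by apply: scale_cts; [exact: cv | exact: cst_cts].
Qed.

Lemma set_type_cts_at (V : topologicalType) (A : set V) (f : T -> A) x :
  {for x, continuous (fun x => \val (f x))} -> {for x, continuous f}.
Proof.
move=> cf U [?/= [[W oW <-]]] /= Wfx /filterS; apply.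
by have := cf W; apply; exact: open_nbhs_nbhs.
Qed.

Lemma set_type_cts (V : topologicalType) (A : set V) (f : T -> A) :
  continuous (fun x => \val (f x)) -> continuous f.
Proof. by move=> cf x; exact: (set_type_cts_at (cf x)). Qed.

End real_continuity.

(** * The Euclidean norm and radial projections *)

Section euclidean_norm.
Context (R : realType).

Definition enorm n (v : 'rV[R]_n) : R := Num.sqrt (sqnorm v).

Lemma sqnorm_cts n : continuous (@sqnorm R n).
Proof.
rewrite /sqnorm.
have c0 : continuous (fun xy : R * R => xy.1 + xy.2).
  by apply: add_cts; [exact: fst_cts | exact: snd_cts].
have := @continuous_big R 'I_n +%R 0 xpredT c0 'rV[R]_n (index_enum _)
  (fun j v => v 0 j ^+ 2).
by apply => i _; apply: mul_cts; exact: coord_continuous.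
Qed.

Lemma enorm_cts n : continuous (@enorm n).
Proof. exact: (comp_cts (@sqnorm_cts n) (@sqrt_continuous R)). Qed.

Lemma sqnorm_ge0 n (v : 'rV[R]_n) : 0 <= sqnorm v.
Proof. by apply: sumr_ge0 => i _; exact: sqr_ge0. Qed.

Lemma enorm_ge0 n (v : 'rV[R]_n) : 0 <= enorm v.
Proof. exact: sqrtr_ge0. Qed.

Lemma sqnormZ n c (v : 'rV[R]_n) : sqnorm (c *: v) = c ^+ 2 * sqnorm v.
Proof.
by rewrite /sqnorm mulr_sumr; apply: eq_bigr => i _; rewrite mxE exprMn.
Qed.

Lemma enormZ n c (v : 'rV[R]_n) : enorm (c *: v) = `|c| * enorm v.
Proof. by rewrite /enorm sqnormZ sqrtrM ?sqr_ge0// sqrtr_sqr. Qed.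

Lemma enorm_sqr n (v : 'rV[R]_n) : enorm v ^+ 2 = sqnorm v.
Proof. by rewrite sqr_sqrtr// sqnorm_ge0. Qed.

Lemma ball_enorm n (v : unit_ball R n) : enorm (\val v) <= 1.
Proof. by case: v => v /= /set_mem /= h; rewrite -sqrtr1 ler_wsqrtr. Qed.

Lemma sphere_enorm n (v : unit_sphere R n) : enorm (\val v) = 1.
Proof. by case: v => v /= /set_mem /= h; rewrite /enorm h sqrtr1. Qed.

Lemma to_ball_subproof n (v : 'rV[R]_n) :
  (Num.max 1 (enorm v))^-1 *: v \in [set v : 'rV[R]_n | sqnorm v <= 1].
Proof.
rewrite inE /= -enorm_sqr enormZ expr_le1 ?mulr_ge0 ?enorm_ge0//.
have m1 : 0 < Num.max 1 (enorm v) by rewrite lt_max ltr01.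
by rewrite gtr0_norm ?invr_gt0// mulrC ler_pdivrMr// mul1r le_max lexx orbT.
Qed.

(** The radial retraction of R^n onto the ball makes every map on the ball
    total, so that formulas may leave the ball. *)
Definition to_ball n (v : 'rV[R]_n) : unit_ball R n :=
  exist _ ((Num.max 1 (enorm v))^-1 *: v) (to_ball_subproof v).

Lemma to_ball_cts n : continuous (@to_ball n).
Proof.
apply: set_type_cts => /=; apply: scale_cts; last by move=> x; exact: cvg_id.
apply: inv_cts; first by move=> x; rewrite gt_eqF// lt_max ltr01.
by apply: max_cts; [exact: cst_cts | exact: enorm_cts].
Qed.

Lemma to_ballK n (v : unit_ball R n) : to_ball (\val v) = v.
Proof.
by apply: val_inj => /=; rewrite (max_idPl (ball_enorm v)) invr1 scale1r.
Qed.

Lemma to_ball_sphere n (s : unit_sphere R n) :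
  to_ball (\val s) = sphere_ball s.
Proof. exact: (to_ballK (sphere_ball s)). Qed.

(** Outside the ball the retraction only depends on the direction. *)
Lemma to_ball_ge1 n (v : 'rV[R]_n) c d :
  1 <= c * enorm v -> 1 <= d * enorm v -> to_ball (c *: v) = to_ball (d *: v).
Proof.
have H e : 1 <= e * enorm v -> \val (to_ball (e *: v)) = (enorm v)^-1 *: v.
  move=> e1; have n0 : 0 < enorm v.
    rewrite lt_def enorm_ge0 andbT; apply/eqP => v0.
    by move: e1; rewrite v0 mulr0 ler10.
  have e0 : 0 < e by rewrite -(pmulr_lgt0 _ n0); apply: lt_le_trans e1.
  rewrite /= enormZ gtr0_norm// (max_idPr e1) scalerA; congr (_ *: _).
  by rewrite invfM mulrAC mulVf ?mul1r// gt_eqF.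
by move=> /H hc /H hd; apply: val_inj; rewrite hc hd.
Qed.

Lemma to_sphere_subproof q (v : 'rV[R]_q.+1) :
  (if enorm v == 0 then delta_mx 0 0 else (enorm v)^-1 *: v)
    \in [set v : 'rV[R]_q.+1 | sqnorm v = 1].
Proof.
rewrite inE /=; case: eqP => [_|/eqP v0]; first exact: sphere_base_subproof.
by rewrite sqnormZ -enorm_sqr -exprMn mulVf// expr1n.
Qed.

(** The value at the origin is arbitrary. *)
Definition to_sphere q (v : 'rV[R]_q.+1) : unit_sphere R q.+1 :=
  exist _ (if enorm v == 0 then delta_mx 0 0 else (enorm v)^-1 *: v)
    (to_sphere_subproof v).

Lemma to_sphere_cts q (v : 'rV[R]_q.+1) :
  enorm v != 0 -> {for v, continuous (@to_sphere q)}.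
Proof.
move=> v0.
have vc : {for v, continuous (fun w => \val (to_sphere w))}.
  have nz : \forall w \near v, enorm w != 0.
    have /(_ [set x : R | x != 0]) := @enorm_cts _ v.
    apply; exact: (open_nbhs_nbhs (conj (@open_neq R 0) v0)).
  have c1 : (enorm w)^-1 *: w @[w --> v] --> (enorm v)^-1 *: v.
    exact: (cvgZ (cvgV v0 (@enorm_cts _ v)) cvg_id).
  rewrite /prop_for /continuous_at /= (negPf v0) => U /c1 HU.
  have HI := @filterI _ _ (nbhs_filter v) _ _ HU nz.
  suff : \forall w \near v, U (if enorm w == 0 then delta_mx 0 0
    else (enorm w)^-1 *: w) by [].
  apply: (@filterS _ _ (nbhs_filter v) _ _ _ HI) => w /= [Hw /negPf w0].
  by rewrite w0.
exact: (set_type_cts_at vc).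
Qed.

Lemma to_sphereZ q (c : R) (s : unit_sphere R q.+1) :
  0 < c -> to_sphere (c *: \val s) = s.
Proof.
move=> c0; apply: val_inj => /=.
rewrite enormZ sphere_enorm mulr1 gtr0_norm// gt_eqF// scalerA.
by rewrite mulVf ?scale1r// gt_eqF.
Qed.

Lemma to_sphereE q (v : 'rV[R]_q.+1) :
  enorm v != 0 -> v = enorm v *: \val (to_sphere v).
Proof. by move=> v0 /=; rewrite (negPf v0) scalerA divff// scale1r. Qed.

End euclidean_norm.

(** * The mapping path space *)

Section unit_interval.
Context (R : realType).

Lemma clamp_val (t : unitI R) : clamp (\val t) = t.
Proof. by apply: val_inj; rewrite clampK// unitI_ge0_le1. Qed.

Lemma unitI_compact : compact [set: unitI R].
Proof.
have -> : [set: unitI R] = @clamp R @` `[0, 1]%classic.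
  apply/seteqP; split => // t _; exists (\val t); last exact: clamp_val.
  by rewrite /= in_itv /=; exact: unitI_ge0_le1.
apply: continuous_compact; last exact: segment_compact.
by apply: continuous_subspaceT => x; exact: clamp_continuous.
Qed.

Lemma unitI_locally_compact : locally_compact [set: unitI R].
Proof.
move=> t _; exists setT; first by rewrite withinET; exact: filterT.
by split; [exact: unitI_compact|exact: closedT].
Qed.

Lemma unitI_regular : regular_space (unitI R).
Proof. exact: (@uniform_regular [set t : R | 0 <= t <= 1]). Qed.

End unit_interval.

Section mapping_path_space.
Context (R : realType) (Y Z : topologicalType) (k : Y -> Z).
Local Notation I := (unitI R).

(** The compact-open topology is put on all functions, continuous or not, so
    continuity of the path is part of the condition. *)
Definition path_pairs : set (Y * {compact-open, I -> Z}) :=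
  [set yg | continuous (yg.2 : I -> Z) /\ yg.2 (unitI1 R) = k yg.1].

Definition path_space : topologicalType := path_pairs.

Definition path_base (e : path_space) : Y := (\val e).1.
Definition path_at (e : path_space) (t : I) : Z := (\val e).2 t.
Definition path_start (e : path_space) : Z := path_at e (unitI0 R).

Lemma path_spaceP (e : path_space) :
  continuous (path_at e) /\ path_at e (unitI1 R) = k (path_base e).
Proof. by have := set_mem (valP e). Qed.

Lemma path_space_eq (e e' : path_space) :
  path_base e = path_base e' -> path_at e =1 path_at e' -> e = e'.
Proof.
move=> eb ep; apply: val_inj; move: eb ep.
rewrite /path_base /path_at; case: (\val e) (\val e') => y g [y' g'] /= -> gg'.
by congr pair; apply/funext.
Qed.

Lemma path_base_cts : continuous path_base.
Proof.
have vc : continuous (fun e : path_space => \val e).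
  exact: initial_continuous.
exact: comp_cts vc (@fst_cts _ _).
Qed.

(** This half of the exponential law needs the unit interval to be locally
    compact and regular. *)
Lemma path_at_cts : continuous (fun et : path_space * I => path_at et.1 et.2).
Proof.
have vc : continuous (fun e : path_space => \val e).
  exact: initial_continuous.
have pc := comp_cts vc (@snd_cts _ _).
have -> : (fun et => path_at et.1 et.2) = uncurry path_at.
  by apply/funext => -[].
exact: (continuous_uncurry_regular (@unitI_locally_compact R) (@unitI_regular R)
  pc (fun e => proj1 (path_spaceP e))).
Qed.

Lemma path_at_comp_cts (X : topologicalType) (e : X -> path_space)
    (t : X -> I) : continuous e -> continuous t ->
  continuous (fun x => path_at (e x) (t x)).
Proof.
by move=> ce ct; exact: (comp_cts (pair_cts ce ct) path_at_cts).
Qed.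

Lemma path_start_cts : continuous path_start.
Proof. by apply: path_at_comp_cts => [x|]; [exact: cvg_id|exact: cst_cts]. Qed.

(** This half of the exponential law, continuity of currying, holds for all
    domains [X]. *)
Lemma into_path_space (X : topologicalType) (y : X -> Y) (g : X * I -> Z) :
  continuous y -> continuous g -> (forall x, g (x, unitI1 R) = k (y x)) ->
  {e : X -> path_space | [/\ continuous e, forall x, path_base (e x) = y x &
    forall x t, path_at (e x) t = g (x, t)]}.
Proof.
move=> cy cg gy.
have [cg1 cg2] := continuous_curry cg.
have P x : (y x, curry g x : {compact-open, I -> Z}) \in path_pairs.
  by rewrite inE; split; [exact: cg2|exact: gy].
exists (fun x => exist _ (y x, curry g x : {compact-open, I -> Z}) (P x)).
split => //.
apply: set_type_cts => /=.
have cg1' : continuous (curry g : X -> {compact-open, I -> Z}) := cg1.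
exact: (@pair_cts X Y {compact-open, I -> Z} y (curry g) cy cg1').
Qed.

Lemma path_space_cts (X : topologicalType) (e : X -> path_space) :
  continuous (fun x => path_base (e x)) ->
  continuous (fun xt : X * I => path_at (e xt.1) xt.2) -> continuous e.
Proof.
move=> c1 c2; have H x : path_at (e x) (unitI1 R) = k (path_base (e x)).
  by case: (path_spaceP (e x)).
have [e' [ce' eb ep]] := into_path_space c1 c2 H.
suff -> : e = e' by [].
by apply/funext => x; apply: path_space_eq => // t; rewrite ep.
Qed.

(** The path of [e' x] runs through [H (x, _)] during the time [u x], then
    through the path of [e x] during a unit of time, and all this is traversed
    at speed [1 + u x]. As only the total duration is rescaled, there is no
    division by [u x], and continuity holds also where [u] vanishes and the
    lift is left unchanged. *)
Lemma path_transport (X : topologicalType) (e : X -> path_space)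
    (H : X * I -> Z) (u : X -> I) :
  continuous e -> continuous H -> continuous u ->
  (forall x, H (x, u x) = path_start (e x)) ->
  {e' : X -> path_space | [/\ continuous e',
    forall x, path_start (e' x) = H (x, unitI0 R),
    forall x, path_base (e' x) = path_base (e x),
    forall x, u x = unitI0 R -> e' x = e x &
    forall x, u x = unitI1 R ->
      (forall t, path_at (e x) t = path_start (e x)) ->
      forall t, path_at (e' x) t = H (x, clamp (2 * \val t))]}.
Proof.
move=> ce cH cu Hu.
pose w (xt : X * I) : R := (1 + \val (u xt.1)) * \val xt.2 - \val (u xt.1).
pose g (xt : X * I) := if w xt <= 0
  then H (xt.1, clamp ((1 + \val (u xt.1)) * \val xt.2))
  else path_at (e xt.1) (clamp (w xt)).
have cux : continuous (fun xt : X * I => \val (u xt.1) : R).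
  exact: comp_cts (comp_cts (@fst_cts _ _) cu) (@val_cts R).
have ct : continuous (fun xt : X * I => \val xt.2 : R).
  exact: comp_cts (@snd_cts _ _) (@val_cts R).
have ca : continuous (fun xt : X * I => (1 + \val (u xt.1)) * \val xt.2).
  by apply: mul_cts => //; apply: add_cts => //; exact: cst_cts.
have cw : continuous w by apply: add_cts => //; exact: opp_cts.
have cg : continuous g.
  apply: glue_cts => // [x _|x _|x].
  - have := comp_cts ca (@clamp_continuous R) => cc.
    exact: (comp_cts (pair_cts (@fst_cts X I) cc) cH).
  - apply: path_at_comp_cts; first exact: comp_cts (@fst_cts _ _) ce.
    exact: comp_cts cw (@clamp_continuous R).
  - move=> wx; rewrite wx (@clamp0 R 0)//; have /eqP := wx.
    by rewrite /w subr_eq0 => /eqP ->; rewrite clamp_val Hu.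
have g1 x : g (x, unitI1 R) = k (path_base (e x)).
  have [_ <-] := path_spaceP (e x).
  by rewrite /g /w /= mulr1 addrK leNgt ltr01 /= clamp1.
have [e' [ce' eb ep]] := into_path_space (comp_cts ce path_base_cts) cg g1.
exists e'; split => //.
- move=> x; rewrite /path_start ep /g /w /= mulr0 sub0r oppr_le0 clamp0//.
  by have /andP[-> _] := unitI_ge0_le1 (u x).
- move=> x ux; apply: path_space_eq => [//|t]; rewrite ep /g /w /= ux /=.
  rewrite addr0 mul1r subr0 clamp_val; case: ifP => // t0.
  have -> : t = unitI0 R by rewrite -(clamp_val t) clamp0.
  by rewrite -{1}ux Hu.
- move=> x ux ce1 t; rewrite ep /g /w /= ux /=.
  case: ifP => // /negbT; rewrite -ltNge subr_gt0 => t1.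
  by rewrite ce1 -Hu ux (clamp1 (ltW t1)).
Qed.

End mapping_path_space.
Arguments path_pairs R {Y Z} k _.

(** * Collars of the ball *)

Section collars.
Context (R : realType) (q : nat).
Local Notation I := (unitI R).
Local Notation B := (unit_ball R q.+1).
Local Notation S := (unit_sphere R q.+1).

Lemma val_to_ball n (v : 'rV[R]_n) : enorm v <= 1 -> \val (to_ball v) = v.
Proof. by move=> v1 /=; rewrite (max_idPl v1) invr1 scale1r. Qed.

(** The ball is seen as a ball of radius 1/2 with the collar S * I glued to
    its boundary: [half_ball] and [collar_pt] parametrise the two parts. *)
Definition half_ball (v : B) : B := to_ball (2^-1 *: \val v).

Definition collar_pt (s : S) (t : I) : B :=
  to_ball (((1 + \val t) / 2) *: \val s).

Lemma val_half_ball v : \val (half_ball v) = 2^-1 *: \val v.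
Proof.
apply: val_to_ball; rewrite enormZ ger0_norm ?invr_ge0//.
by have := ball_enorm v; have := enorm_ge0 (\val v); lra.
Qed.

Lemma val_collar_pt s t : \val (collar_pt s t) = ((1 + \val t) / 2) *: \val s.
Proof.
apply: val_to_ball; rewrite enormZ sphere_enorm mulr1.
have /andP[t0 t1] := unitI_ge0_le1 t.
by rewrite ger0_norm; lra.
Qed.

Lemma collar_pt1 s : collar_pt s (unitI1 R) = sphere_ball s.
Proof.
rewrite -to_ball_sphere /collar_pt /=; congr to_ball.
by rewrite -[RHS]scale1r; congr (_ *: _); lra.
Qed.

Lemma collar_cases (v : B) : (exists w, v = half_ball w) \/
  (exists s t, v = collar_pt s t).
Proof.
have v1 := ball_enorm v.
case: (leP (enorm (\val v)) 2^-1) => [vh|/ltW vh]; [left|right].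
  exists (to_ball (2 *: \val v)); apply: val_inj.
  have v2 : enorm (2 *: \val v) <= 1 by rewrite enormZ ger0_norm//; lra.
  by rewrite val_half_ball val_to_ball// scalerA mulVf ?scale1r// pnatr_eq0.
exists (to_sphere (\val v)), (clamp (2 * enorm (\val v) - 1)).
apply: val_inj; rewrite val_collar_pt clampK; last by apply/andP; split; lra.
have -> : (1 + (2 * enorm (\val v) - 1)) / 2 = enorm (\val v) by lra.
by apply: to_sphereE; apply/eqP; lra.
Qed.

Lemma collar_glue (W : topologicalType) (a : B -> W) (b : S * I -> W) :
  continuous a -> continuous b ->
  (forall s, b (s, unitI0 R) = a (sphere_ball s)) ->
  {c : B -> W | [/\ continuous c, forall v, c (half_ball v) = a v &
    forall s t, c (collar_pt s t) = b (s, t)]}.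
Proof.
move=> ca cb ab.
pose r (v : B) : R := enorm (\val v).
have cv : continuous (fun v : B => \val v : 'rV[R]_q.+1).
  exact: initial_continuous.
have cr : continuous r := comp_cts cv (@enorm_cts R q.+1).
pose F (v : B) := a (to_ball (2 *: \val v)).
pose G (v : B) := b (to_sphere (\val v), clamp (2 * r v - 1)).
have cF : continuous F.
  have := scale_cts (@cst_cts B R 2) cv => c2.
  exact: comp_cts (comp_cts c2 (@to_ball_cts R q.+1)) ca.
have cl : continuous (fun v : B => clamp (2 * r v - 1)).
  have c1 : continuous (fun v : B => 2 * r v - 1).
    by apply: add_cts; [apply: mul_cts => //|]; exact: cst_cts.
  exact: comp_cts c1 (@clamp_continuous R).
have FG v : r v = 2^-1 -> F v = G v.
  move=> rv; rewrite /F /G rv clamp0; last by lra.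
  rewrite ab -to_ball_sphere; congr a; congr to_ball.
  rewrite {1}[\val v]to_sphereE; last by rewrite -/(r v) rv; apply/eqP; lra.
  by rewrite -/(r v) rv scalerA divff ?scale1r// pnatr_eq0.
exists (fun v => if r v <= 2^-1 then F v else G v); split.
- apply: glue_cts => // [x _|x rx]; first exact: cF.
  have x0 : enorm (\val x) != 0 by apply/eqP; move: rx; rewrite /r; lra.
  have c3 : {for x, continuous (fun v : B => to_sphere (\val v))}.
    exact: (@continuous_comp B _ S _ _ x (cv x) (to_sphere_cts x0)).
  have c4 : {for x, continuous (fun v : B =>
      (to_sphere (\val v), clamp (2 * r v - 1)))}.
    exact: (cvg_pair c3 (cl x)).
  exact: (continuous_comp c4 (cb _)).
- move=> v; rewrite /r val_half_ball enormZ ger0_norm ?invr_ge0//.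
  have v1 := ball_enorm v; rewrite ifT; last by lra.
  by rewrite /F val_half_ball scalerA divff ?pnatr_eq0// scale1r to_ballK.
- move=> s t; have /andP[t0 t1] := unitI_ge0_le1 t.
  have rE : r (collar_pt s t) = (1 + \val t) / 2.
    by rewrite /r val_collar_pt enormZ sphere_enorm mulr1 ger0_norm; lra.
  have GE : G (collar_pt s t) = b (s, t).
    rewrite /G rE val_collar_pt to_sphereZ; last by lra.
    have -> : 2 * ((1 + \val t) / 2) - 1 = \val t by lra.
    by rewrite clamp_val.
  case: ifPn => // r1; rewrite FG//; apply/eqP; rewrite eq_le r1 rE; lra.
Qed.

(** Attaching [K] to [a] as a collar gives a map with the right boundary value
    that lifts not [path_start \o a] but its composite with the map
    v |-> to_ball (2 v). The latter is joined to the identity by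
    v |-> to_ball ((1 + t) v), along which the lift is transported back; at
    radius r the time min (1, 2 - 2 r) suffices, and it vanishes on the
    boundary. *)
Lemma boundary_slide (Y Z : topologicalType) (k : Y -> Z)
    (a : B -> path_space R k) (K : S * I -> path_space R k) :
  continuous a -> continuous K ->
  (forall s, K (s, unitI0 R) = a (sphere_ball s)) ->
  (forall s t, path_start (K (s, t)) = path_start (a (sphere_ball s))) ->
  {g : B -> path_space R k | [/\ continuous g,
    forall s, g (sphere_ball s) = K (s, unitI1 R) &
    forall v, path_start (g v) = path_start (a v)]}.
Proof.
move=> ca cK Ka pK.
have [c [cc ch cs]] := collar_glue ca cK Ka.
have cv : continuous (fun v : B => \val v : 'rV[R]_q.+1).
  exact: initial_continuous.
have pc v : path_start (c v) = path_start (a (to_ball (2 *: \val v))).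
  have [[w ->]|[s [t ->]]] := collar_cases v.
    by rewrite ch val_half_ball scalerA divff ?pnatr_eq0// scale1r to_ballK.
  have /andP[t0 t1] := unitI_ge0_le1 t.
  rewrite cs pK val_collar_pt scalerA -to_ball_sphere -[\val s in LHS]scale1r.
  rewrite (@to_ball_ge1 _ _ _ _ (2 * ((1 + \val t) / 2)))//.
    by rewrite sphere_enorm; lra.
  by rewrite sphere_enorm; lra.
pose H (vt : B * I) := path_start (a (to_ball ((1 + \val vt.2) *: \val vt.1))).
pose u (v : B) := clamp (2 - 2 * enorm (\val v)).
have cH : continuous H.
  apply: (comp_cts _ (@path_start_cts R Y Z k)); apply: (comp_cts _ ca).
  apply: (comp_cts _ (@to_ball_cts R _)); apply: scale_cts.
    apply: add_cts; first exact: cst_cts.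
    exact: comp_cts (@snd_cts _ _) (@val_cts R).
  exact: comp_cts (@fst_cts _ _) cv.
have cu : continuous u.
  apply: (comp_cts _ (@clamp_continuous R)).
  apply: add_cts; first exact: cst_cts.
  apply: opp_cts; apply: mul_cts; first exact: cst_cts.
  exact: comp_cts cv (@enorm_cts R _).
have Hu v : H (v, u v) = path_start (c v).
  rewrite pc; congr (path_start (a _)); rewrite [LHS]/=.
  rewrite -[LHS]/(to_ball ((1 + \val (u v)) *: \val v)).
  have v1 := ball_enorm v.
  case: (leP (enorm (\val v)) 2^-1) => vh.
    by congr (to_ball (_ *: _)); rewrite /u clamp1 /=; lra.
  rewrite /u clampK; last by apply/andP; split; lra.
  (* (3 - 2 r) r >= 1 for 1/2 <= r <= 1, as (2 r - 1) (1 - r) >= 0 *)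
  by apply: to_ball_ge1; nra.
have [g [cg pg _ ug _]] := path_transport cc cH cu Hu.
exists g; split => //.
- move=> s; rewrite ug.
    by rewrite -collar_pt1 cs.
  by rewrite /u clamp0// (sphere_enorm s); lra.
- by move=> v; rewrite pg /H /= addr0 scale1r to_ballK.
Qed.

End collars.

(** * Hemispheres *)

Section hemispheres.
Context (R : realType) (q : nat).
Local Notation B := (unit_ball R q.+1).
Local Notation S1 := (unit_sphere R q.+1).
Local Notation S2 := (unit_sphere R q.+2).

(** The last coordinate is the vertical one, so that the base point, which is
    the first basis vector, lies on the equator. *)
Definition equator_proj (w : 'rV[R]_q.+2) : 'rV[R]_q.+1 :=
  \row_j w 0 (lift ord_max j).

Definition height (w : 'rV[R]_q.+2) : R := w 0 ord_max.

Definition with_height (v : 'rV[R]_q.+1) (c : R) : 'rV[R]_q.+2 :=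
  \row_j (if unlift ord_max j is Some i then v 0 i else c).

Lemma equator_projK v c : equator_proj (with_height v c) = v.
Proof. by apply/rowP => j; rewrite !mxE liftK. Qed.

Lemma height_with v c : height (with_height v c) = c.
Proof. by rewrite /height mxE unlift_none. Qed.

Lemma sqnorm_split w : sqnorm w = sqnorm (equator_proj w) + height w ^+ 2.
Proof.
rewrite /sqnorm big_ord_recr /=; congr (_ + _).
apply: eq_bigr => j _; rewrite mxE; congr (w _ _ ^+ 2).
by apply: val_inj; rewrite /= /bump leqNgt ltn_ord.
Qed.

Lemma height_cts : continuous height.
Proof. exact: coord_continuous. Qed.

Lemma equator_proj_cts : continuous equator_proj.
Proof.
apply: rV_cts => j.
under [X in continuous X]eq_fun do rewrite mxE.
exact: coord_continuous.
Qed.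

Lemma with_height_base :
  with_height (delta_mx 0 0 : 'rV[R]_q.+1) 0 = delta_mx 0 0.
Proof.
apply/rowP => j; rewrite !mxE /=; case: unliftP => [i ->|->]; rewrite ?mxE //=.
by congr (nat_of_bool _)%:R; rewrite -!val_eqE /= /bump leqNgt ltn_ord.
Qed.

Definition vproj (w : S2) : B := to_ball (equator_proj (\val w)).

Lemma vproj_cts : continuous vproj.
Proof.
have cv : continuous (fun v : S2 => \val v : 'rV[R]_q.+2).
  exact: initial_continuous.
exact: (comp_cts (comp_cts cv equator_proj_cts) (@to_ball_cts R q.+1)).
Qed.

Lemma vproj_height0 w :
  height (\val w) = 0 -> exists s : S1, vproj w = sphere_ball s.
Proof.
move=> h0; exists (to_sphere (equator_proj (\val w))).
have n1 : enorm (equator_proj (\val w)) = 1.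
  have := sphere_enorm w.
  by rewrite /enorm sqnorm_split h0 expr0n addr0.
rewrite -to_ball_sphere /vproj; congr to_ball.
by rewrite {1}[equator_proj _]to_sphereE ?n1 ?scale1r ?oner_eq0.
Qed.

Lemma hemi_subproof (b : bool) (v : B) :
  with_height (\val v) ((-1) ^+ b * Num.sqrt (1 - sqnorm (\val v)))
    \in [set w : 'rV[R]_q.+2 | sqnorm w = 1].
Proof.
rewrite inE /= sqnorm_split equator_projK height_with exprMn sqrr_sign mul1r.
have v1 : sqnorm (\val v) <= 1 by have := set_mem (valP v).
by rewrite sqr_sqrtr ?subr_ge0// addrC subrK.
Qed.

Definition hemi (b : bool) (v : B) : S2 :=
  exist _ (with_height (\val v) ((-1) ^+ b * Num.sqrt (1 - sqnorm (\val v))))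
    (hemi_subproof b v).

Lemma hemi_cts b : continuous (hemi b).
Proof.
have cv : continuous (fun v : B => \val v : 'rV[R]_q.+1).
  exact: initial_continuous.
apply: set_type_cts; apply: rV_cts => j.
under [X in continuous X]eq_fun do rewrite /= mxE.
case: unlift => [i|].
  exact: comp_cts cv (@coord_continuous _ _ _ _ _).
apply: mul_cts; first exact: cst_cts.
apply: (comp_cts _ (@sqrt_continuous R)).
apply: add_cts; first exact: cst_cts.
exact/opp_cts/(comp_cts cv)/sqnorm_cts.
Qed.

Lemma vproj_hemi b v : vproj (hemi b v) = v.
Proof. by rewrite /vproj /= equator_projK to_ballK. Qed.

Lemma hemi_sphere (s : S1) b b' :
  hemi b (sphere_ball s) = hemi b' (sphere_ball s).
Proof.
apply: val_inj => /=; have -> : sqnorm (\val s) = 1 := set_mem (valP s).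
by rewrite subrr sqrtr0 !mulr0.
Qed.

Lemma hemi_base b :
  hemi b (sphere_ball (sphere_base R q)) = sphere_base R q.+1.
Proof.
apply: val_inj => /=.
by rewrite sphere_base_subproof subrr sqrtr0 mulr0 with_height_base.
Qed.

Lemma sphere_glue (W : topologicalType) (lo up : B -> W) :
  continuous lo -> continuous up ->
  (forall s, lo (sphere_ball s) = up (sphere_ball s)) ->
  {c : S2 -> W | [/\ continuous c, forall v, c (hemi true v) = lo v &
    forall v, c (hemi false v) = up v]}.
Proof.
move=> cl cu lu.
have cv : continuous (fun v : S2 => \val v : 'rV[R]_q.+2).
  exact: initial_continuous.
have agree w : height (\val w) = 0 -> lo (vproj w) = up (vproj w).
  by move=> /vproj_height0 [s ->].
exists (fun w => if height (\val w) <= 0 then lo (vproj w)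
  else up (vproj w)); split.
- apply: glue_cts => [|x _|x _|//]; first exact: (comp_cts cv height_cts).
    exact: (comp_cts vproj_cts cl).
  exact: (comp_cts vproj_cts cu).
- move=> v; rewrite ifT ?vproj_hemi//= height_with expr1 mulN1r oppr_le0.
  exact: sqrtr_ge0.
- move=> v; case: ifPn => [h|]; last by rewrite vproj_hemi.
  rewrite agree ?vproj_hemi//; apply/eqP; rewrite eq_le h /=.
  by rewrite height_with expr0 mul1r sqrtr_ge0.
Qed.

End hemispheres.

(** * From homotopy groups to extensions *)

Section homotopy_groups.
Context (R : realType) (Y Z : topologicalType) (k : continuousType Y Z).
Local Notation I := (unitI R).

Definition ball_segment n (v w : unit_ball R n) (t : R) : unit_ball R n :=
  to_ball ((1 - t) *: \val v + t *: \val w).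

Lemma ball_segment0 n (v w : unit_ball R n) : ball_segment v w 0 = v.
Proof. by rewrite /ball_segment subr0 scale1r scale0r addr0 to_ballK. Qed.

Lemma ball_segment1 n (v w : unit_ball R n) : ball_segment v w 1 = w.
Proof. by rewrite /ball_segment subrr scale1r scale0r add0r to_ballK. Qed.

Lemma ball_segmentxx n (v : unit_ball R n) t : ball_segment v v t = v.
Proof. by rewrite /ball_segment -scalerDl subrK scale1r to_ballK. Qed.

Lemma ball_segment_cts n (w : unit_ball R n) (T : topologicalType)
    (v : T -> unit_ball R n) (t : T -> R) : continuous v -> continuous t ->
  continuous (fun x => ball_segment (v x) w (t x)).
Proof.
move=> cv ct; apply: (comp_cts _ (@to_ball_cts R n)).
have cval : continuous (fun v : unit_ball R n => \val v : 'rV[R]_n).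
  exact: initial_continuous.
apply: addv_cts; apply: scale_cts => //.
- by apply: add_cts; [exact: cst_cts | exact: opp_cts].
- exact: comp_cts cv cval.
- exact: cst_cts.
Qed.

Lemma sphere0_coord (s : unit_sphere R 1) :
  \val s 0 0 = 1 \/ \val s 0 0 = -1 :> R.
Proof.
have /= := set_mem (valP s); rewrite /sqnorm big_ord1 => /eqP.
by rewrite sqrf_eq1 => /orP[] /eqP; [left|right].
Qed.

Lemma sphere0_eq (s s' : unit_sphere R 1) :
  \val s 0 0 = \val s' 0 0 -> s = s'.
Proof. by move=> ss'; apply/val_inj/rowP => j; rewrite ord1. Qed.

Definition sphere0_antipode : unit_sphere R 1 := to_sphere (- delta_mx 0 0).

Lemma sphere0_antipodeE : \val sphere0_antipode 0 0 = -1.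
Proof.
have n1 : enorm (- delta_mx 0 0 : 'rV[R]_1) = 1.
  by rewrite -scaleN1r enormZ normrN1 mul1r /enorm sphere_base_subproof sqrtr1.
by rewrite /= n1 oner_eq0 invr1 scale1r !mxE.
Qed.

(** The base point is not moved by the contraction of the ball onto it along
    segments, so [F] gives a based null homotopy of [k \o g]. For [q = 0] the
    sphere has two points, and a path between their images is needed. *)
Lemma sphere_contract q (g : unit_sphere R q.+1 -> Y)
    (F : unit_ball R q.+1 -> Z) :
  pi_bijective R k q -> continuous g -> continuous F ->
  (forall s, F (sphere_ball s) = k (g s)) ->
  exists H : unit_sphere R q.+1 * I -> Y, [/\ continuous H,
    forall s, H (s, unitI0 R) = g s &
    forall s, H (s, unitI1 R) = g (sphere_base R q)].
Proof.
set b := sphere_base R q => kq cg cF Fk.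
pose N (st : unit_sphere R q.+1 * I) :=
  F (ball_segment (sphere_ball st.1) (sphere_ball b) (\val st.2)).
have cN : continuous N.
  apply: (comp_cts _ cF); apply: ball_segment_cts.
    exact: (comp_cts (@fst_cts _ _) (@sphere_ball_continuous R q.+1)).
  exact: (comp_cts (@snd_cts _ _) (@val_cts R)).
have N0 s : N (s, unitI0 R) = k (g s) by rewrite /N /= ball_segment0 Fk.
have N1 s : N (s, unitI1 R) = k (g b) by rewrite /N /= ball_segment1 Fk.
case: q => [|q] in g F b kq cg cF Fk N cN N0 N1 *.
  pose a := sphere0_antipode.
  have ka : path_joined R (k (g a)) (k (g b)).
    exists (fun t => N (a, t)); split => //.
    by apply: (comp_cts _ cN); apply: pair_cts => [|x];
      [exact: cst_cts|exact: cvg_id].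
  have [p [cp p0 p1]] : path_joined R (g a) (g b).
    apply/pi0_classP; apply: (bij_inj kq).
    by rewrite !pi0_mapE; exact/pi0_classP.
  pose x (st : unit_sphere R 1 * I) : R := (\val st.1 : 'rV[R]_1) 0 0.
  have cx : continuous x.
    have cv : continuous (fun s : unit_sphere R 1 => \val s : 'rV[R]_1).
      exact: initial_continuous.
    have c1 := comp_cts cv (@coord_continuous _ _ _ 0 0).
    exact: comp_cts (@fst_cts _ _) c1.
  exists (fun st => if x st <= 0 then p st.2 else g b); split.
  - apply: glue_cts => // [st _|st _|st x0].
    + exact: (comp_cts (@snd_cts _ _) cp).
    + exact: cst_cts.
    + by exfalso; have := sphere0_coord st.1; rewrite -/(x st) x0; case; lra.
  - move=> s; rewrite /x /=; have [s1|s1] := sphere0_coord s.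
      rewrite s1 ifF; last by apply/negbTE; rewrite -ltNge ltr01.
      by congr g; apply: sphere0_eq; rewrite s1 /= mxE.
    rewrite s1 ifT ?lerN10// p0; congr g; apply: sphere0_eq.
    by rewrite sphere0_antipodeE s1.
  - by move=> s /=; rewrite p1 if_same.
have ga : g \in @based_maps R q.+1 Y (g b) by rewrite inE; split.
have gc : cst (g b) \in @based_maps R q.+1 Y (g b).
  by rewrite inE; split => //; exact: cst_cts.
pose A : @based_maps R q.+1 Y (g b) := exist _ g ga.
pose C : @based_maps R q.+1 Y (g b) := exist _ (cst (g b)) gc.
have /hpi_classP [H [cH H0 H1 _]] : hpi_class A = hpi_class C.
  apply: (bij_inj (kq (g b))); rewrite !hpi_mapE; apply/hpi_classP.
  exists N; split => // w t -> /=.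
  by rewrite /N /= ball_segmentxx Fk.
by exists H.
Qed.

Lemma sphere_extension q (g : unit_sphere R q.+1 -> Y)
    (F : unit_ball R q.+1 -> Z) :
  pi_bijective R k q -> continuous g -> continuous F ->
  (forall s, F (sphere_ball s) = k (g s)) ->
  exists2 G : unit_ball R q.+1 -> Y, continuous G &
    forall s, G (sphere_ball s) = g s.
Proof.
move=> kq cg cF Fk.
have [H [cH H0 H1]] := sphere_contract kq cg cF Fk.
pose b (st : unit_sphere R q.+1 * I) := H (st.1, clamp (-1 * \val st.2 + 1)).
have cb : continuous b by exact: reparam_cts.
have [|G [cG _ GE]] := collar_glue (@cst_cts (unit_ball R q.+1) Y
  (g (sphere_base R q))) cb.
  by move=> s; rewrite /b clamp1 ?H1//= mulr0 add0r.
exists G => // s; rewrite -collar_pt1 GE /b clamp0 ?H0//=.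
by rewrite mulr1 addNr.
Qed.

Lemma sphere_lift q (y : Y) (c : unit_sphere R q.+2 -> Z) :
  pi_surjective R k q.+1 -> continuous c ->
  c (sphere_base R q.+1) = k y ->
  exists a : unit_sphere R q.+2 -> Y,
    [/\ continuous a, a (sphere_base R q.+1) = y &
      homotopic R [set sphere_base R q.+1] (k \o a) c].
Proof.
move=> kq cc cy.
have cP : c \in @based_maps R q.+1 Z (k y) by rewrite inE; split.
have [x] := kq y (hpi_class (exist _ c cP : @based_maps R q.+1 Z (k y))).
rewrite /hpi_map => /hpi_classP /=.
set a := repr _ => ac; have [ca ay] := set_mem (valP a).
by exists (\val a).
Qed.

End homotopy_groups.

(** * Lifting over one ball *)

Section ball_lifting.
Context (R : realType).
Local Notation I := (unitI R).

(** Contract the ball to [v0] along [a], then expand again along [b]: this lifts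
    a homotopy that moves v towards [v0] and back, and transporting it along the
    segment from v makes it constant in Z. *)
Lemma fibre_homotopy n (Y Z : topologicalType) (k : Y -> Z)
    (a b : unit_ball R n -> path_space R k) (v0 : unit_ball R n) :
  continuous a -> continuous b ->
  (forall v, path_start (a v) = path_start (b v)) -> a v0 = b v0 ->
  {K : unit_ball R n * I -> path_space R k | [/\ continuous K,
    forall v, K (v, unitI0 R) = a v, forall v, K (v, unitI1 R) = b v &
    forall v t, path_start (K (v, t)) = path_start (a v)]}.
Proof.
move=> ca cb pab ab0.
pose T := (unit_ball R n * I)%type.
pose x (vt : T) : R := \val vt.2.
have cx : continuous x by exact: comp_cts (@snd_cts _ _) (@val_cts R).
have c1 : continuous (fst : T -> unit_ball R n) := @fst_cts _ _.
have seg (c d : R) (W : topologicalType) (e : unit_ball R n -> W) :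
    continuous e ->
    continuous (fun vt : T => e (ball_segment vt.1 v0 (c * x vt + d))).
  move=> ce; apply: (comp_cts _ ce); apply: ball_segment_cts => //.
  by apply: add_cts; [apply: mul_cts => //|]; exact: cst_cts.
pose F (vt : T) := a (ball_segment vt.1 v0 (2 * x vt + 0)).
pose G (vt : T) := b (ball_segment vt.1 v0 (-2 * x vt + 2)).
pose K0 (vt : T) := if x vt <= 2^-1 then F vt else G vt.
have cK0 : continuous K0.
  apply: glue_cts => // [vt _|vt _|vt xE]; [exact: seg|exact: seg|].
  rewrite /F /G xE.
  have -> : 2 * 2^-1 + 0 = 1 :> R by lra.
  have -> : -2 * 2^-1 + 2 = 1 :> R by lra.
  by rewrite !ball_segment1.
pose u (vt : T) := clamp (Num.min (2 * x vt) (2 - 2 * x vt)).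
have cu : continuous u.
  apply: (comp_cts _ (@clamp_continuous R)).
  have c2x : continuous (fun vt => 2 * x vt).
    by apply: mul_cts => //; exact: cst_cts.
  apply: min_cts => //; apply: add_cts; first exact: cst_cts.
  exact: opp_cts.
pose H (vts : T * I) :=
  path_start (a (ball_segment vts.1.1 v0 (\val vts.2))).
have cH : continuous H.
  apply: (comp_cts _ (@path_start_cts R Y Z k)); apply: (comp_cts _ ca).
  apply: ball_segment_cts; first exact: comp_cts (@fst_cts _ _) c1.
  exact: comp_cts (@snd_cts _ _) (@val_cts R).
have uE vt : \val (u vt) = Num.min (2 * x vt) (2 - 2 * x vt).
  rewrite /u clampK//; have /andP[t0 t1] := unitI_ge0_le1 vt.2.
  by rewrite le_min ge_min /x; apply/andP; split; [apply/andP; split|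
    case: (leP (\val vt.2) 2^-1) => h; apply/orP; [left|right]]; lra.
have HE vt : H (vt, u vt) = path_start (K0 vt).
  have HH : H (vt, u vt) =
    path_start (a (ball_segment vt.1 v0 (\val (u vt)))) by [].
  rewrite HH uE /K0; case: ifPn => [xh|].
    rewrite /F min_l; last by lra.
    by rewrite addr0.
  rewrite -ltNge => xh; rewrite /G -pab min_r; last by lra.
  by congr (path_start (a (ball_segment _ _ _))); lra.
have [K [cK pK _ uK _]] := path_transport cK0 cH cu HE.
have u0 v : u (v, unitI0 R) = unitI0 R.
  apply: val_inj; rewrite uE /x /= mulr0 subr0 min_l//.
have u1 v : u (v, unitI1 R) = unitI0 R.
  apply: val_inj; rewrite uE /x /= mulr1 subrr min_r//.
exists K; split => //.
- move=> v; rewrite uK ?u0// /K0 /x /= invr_ge0 ler0n /F /x /= mulr0 addr0.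
  by rewrite ball_segment0.
- move=> v; rewrite uK ?u1// /K0 /x /= ifF; last first.
    by apply/negbTE; rewrite -ltNge; lra.
  by rewrite /G /x /= mulr1 addNr ball_segment0.
- by move=> v t; rewrite pK /H /= ball_segment0.
Qed.

(** In the notation of the overview, [a'] is the lift of the map on S^(q+1),
    [G'] is (G, const), [g'] lifts [f1], [e'] lifts [f] with boundary value h
    followed by a constant path, and [K'] shrinks the constant part. *)
Theorem ball_lift q (Y Z : topologicalType) (k : continuousType Y Z)
    (f : unit_ball R q.+1 -> Z) (e : unit_sphere R q.+1 -> path_space R k) :
  pi_bijective R k q -> pi_surjective R k q.+1 ->
  continuous f -> continuous e ->
  (forall s, path_start (e s) = f (sphere_ball s)) ->
  exists l : unit_ball R q.+1 -> path_space R k, [/\ continuous l,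
    forall s, l (sphere_ball s) = e s & forall v, path_start (l v) = f v].
Proof.
move=> kq kSq cf ce ef.
pose S := unit_sphere R q.+1.
have ck : continuous k := @cts_fun _ _ k.
pose g s := path_base (e s).
have cg : continuous g := comp_cts ce (@path_base_cts R Y Z k).
pose h (st : S * I) := path_at (e st.1) st.2.
have ch : continuous h.
  apply: path_at_comp_cts; last exact: snd_cts.
  exact: comp_cts (@fst_cts _ _) ce.
have h1 s : h (s, unitI1 R) = k (g s) by case: (path_spaceP (e s)).
have [f1 [cf1 f1h f1s]] := collar_glue cf ch ef.
have f1b s : f1 (sphere_ball s) = k (g s) by rewrite -collar_pt1 f1s h1.
have [G cG Gg] := sphere_extension kq cg cf1 f1b.
pose s0 := sphere_base R q.
have [c [cc clo cup]] := sphere_glue cf1 (comp_cts cG ck)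
  (fun s => etrans (f1b s) (congr1 k (esym (Gg s)))).
have c0 : c (sphere_base R q.+1) = k (g s0).
  by rewrite -(hemi_base R q false) cup /= Gg.
have [a [ca a0 [N [cN N0 N1 Nb]]]] := sphere_lift kSq cc c0.
(* the homotopy is reversed: the path of [a' w] runs from [c w] to [k (a w)] *)
have [a' [ca' a'b a'p]] : {a' : _ -> path_space R k | [/\ continuous a',
    forall w, path_base (a' w) = a w &
    forall w t, path_at (a' w) t = N (w, clamp (-1 * \val t + 1))]}.
  have cN' := reparam_cts (a := -1) (b := 1) cN.
  apply: (into_path_space (g := fun wt => N (wt.1, clamp (-1 * \val wt.2 + 1)))
    ca cN') => w.
  by rewrite /= clamp0 ?N0// mulr1 addNr.
have a's w : path_start (a' w) = c w.
  by rewrite /path_start a'p clamp1 ?N1//= mulr0 add0r.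
have [G' [cG' G'b G'p]] : {G' : _ -> path_space R k | [/\ continuous G',
    forall v, path_base (G' v) = G v & forall v t, path_at (G' v) t = k (G v)]}.
  apply: (into_path_space (g := fun vt => k (G vt.1)) cG) => //.
  exact: comp_cts (comp_cts (@fst_cts _ _) cG) ck.
have ab0 : a' (hemi false (sphere_ball s0)) = G' (sphere_ball s0).
  rewrite hemi_base; apply: path_space_eq; first by rewrite a'b G'b a0 Gg.
  by move=> t; rewrite a'p G'p Gg Nb//= a0.
(* both are lifts of [k \o G] *)
have [|K [cK K0 K1 pK]] := fibre_homotopy
    (comp_cts (@hemi_cts R q false) ca') cG' _ ab0.
  by move=> v; rewrite /= a's cup /path_start G'p.
have [||||g' [cg' g's g'p]] := boundary_slide (a := a' \o hemi true)
    (K := fun st : S * I => K (sphere_ball st.1, st.2)).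
- exact: comp_cts (@hemi_cts R q true) ca'.
- apply: (comp_cts _ cK); apply: pair_cts; last exact: snd_cts.
  exact: comp_cts (@fst_cts _ _) (@sphere_ball_continuous R _).
- by move=> s; rewrite K0 /= (hemi_sphere s true false).
- by move=> s t; rewrite pK /= (hemi_sphere s true false).
have g'f v : path_start (g' v) = f1 v by rewrite g'p /= a's clo.
have g'E s : g' (sphere_ball s) = G' (sphere_ball s) by rewrite g's K1.
pose H (vt : unit_ball R q.+1 * I) :=
  f1 (to_ball (((1 + \val vt.2) / 2) *: \val vt.1)).
have cH : continuous H.
  apply: (comp_cts _ cf1); apply: (comp_cts _ (@to_ball_cts R _)).
  apply: scale_cts; last first.
    exact: comp_cts (@fst_cts _ _) (@initial_continuous _ _ _).
  apply: mul_cts; last exact: cst_cts.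
  apply: add_cts; first exact: cst_cts.
  exact: comp_cts (@snd_cts _ _) (@val_cts R).
have [||e' [ce' e'p e'B _ e'1]] := path_transport (u := cst (unitI1 R)) cg' cH.
- exact: cst_cts.
- move=> v; rewrite g'f /H /=; have -> : (1 + 1) / 2 = 1 :> R by lra.
  by rewrite scale1r to_ballK.
have e'f v : path_start (e' v) = f v.
  by rewrite e'p /H /= addr0 mul1r -/(half_ball v) f1h.
have e'b s : path_base (e' (sphere_ball s)) = g s.
  by rewrite e'B g'E G'b Gg.
have e't s t : path_at (e' (sphere_ball s)) t = h (s, clamp (2 * \val t)).
  rewrite e'1//; first by rewrite /H -f1s.
  by move=> t'; rewrite /path_start g'E !G'p.
pose r (t' t : I) : I := clamp ((2 - \val t') * \val t).
have [K' [cK' K'b K'p]] : {K' : S * I -> path_space R k | [/\ continuous K',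
    forall st, path_base (K' st) = g st.1 &
    forall st t, path_at (K' st) t = h (st.1, r st.2 t)]}.
  apply: (into_path_space (g := fun x => h (x.1.1, r x.1.2 x.2))).
  - exact: comp_cts (@fst_cts _ _) cg.
  - apply: (comp_cts _ ch); apply: pair_cts.
      exact: comp_cts (@fst_cts _ _) (@fst_cts _ _).
    apply: (comp_cts _ (@clamp_continuous R)); apply: mul_cts; last first.
      exact: comp_cts (@snd_cts _ _) (@val_cts R).
    apply: add_cts; first exact: cst_cts.
    apply/opp_cts/(comp_cts _ (@val_cts R)).
    exact: comp_cts (@fst_cts _ _) (@snd_cts _ _).
  - move=> [s t]; have /andP[_ t1] := unitI_ge0_le1 t.
    have r1 : r t (unitI1 R) = unitI1 R.
      by rewrite /r clamp1// [\val (unitI1 R)]/= mulr1; lra.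
    by rewrite r1 h1.
have K'0 s : K' (s, unitI0 R) = e' (sphere_ball s).
  apply: path_space_eq => [|t]; first by rewrite K'b e'b.
  by rewrite K'p e't /r /= subr0.
have K's st : path_start (K' st) = f (sphere_ball st.1).
  rewrite /path_start K'p /r /= mulr0 clamp0// -ef; exact: erefl.
have [|l [cl ls lp]] := boundary_slide ce' cK' K'0.
  by move=> s t; rewrite K's e'f.
exists l; split=> // [s|v]; last by rewrite lp e'f.
rewrite ls; apply: path_space_eq => [|t]; first by rewrite K'b.
rewrite K'p /r /=; have -> : 2 - 1 = 1 :> R by lra.
by rewrite mul1r clamp_val.
Qed.

End ball_lifting.

(** * Equivariant maps and projective M-sets *)

Section equivariant_maps.
Context (M : monoidType).
Implicit Types X Y Z : mSpaceType M.

Lemma mact_cts X (m : M) : continuous (mact m : X -> X).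
Proof.
have c := pair_cts (@cst_cts X (discrete_topology M) m)
  (fun x : X => @cvg_id _ (nbhs x)).
exact: (comp_cts c (@mact_continuous M X)).
Qed.

Definition mmap_of X Y (f : X -> Y) (cf : continuous f) (ef : equivariant f) :
    mMapType X Y :=
  HB.pack f (isContinuous.Build X Y f cf) (isEquivariant.Build M X Y f ef).

Definition mmap_comp X Y Z (g : mMapType Y Z) (f : mMapType X Y) :
    mMapType X Z.
Proof.
apply: (@mmap_of _ _ (g \o f)) => [|m x].
  exact: comp_cts (@cts_fun _ _ f) (@cts_fun _ _ g).
by rewrite /= !mmapP.
Defined.

End equivariant_maps.

Section free_actions.
Context (M : monoidType) (P : mSetType M).

Definition free_mset : Type := (M * P)%type.

HB.instance Definition _ := Choice.on free_mset.

Definition free_act (m : M) (x : free_mset) : free_mset :=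
  ((m * x.1)%g, x.2).

Lemma free_act1 x : free_act 1%g x = x.
Proof. by case: x => m p; rewrite /free_act mul1g. Qed.

Lemma free_actM m n x : free_act (m * n)%g x = free_act m (free_act n x).
Proof. by rewrite /free_act mulgA. Qed.

HB.instance Definition _ := isMSet.Build M free_mset free_act1 free_actM.

(** A section of the action map from the free M-set on P. *)
Lemma projective_coord : projective P ->
  exists c : P -> M, exists b : P -> P, [/\ forall p, mact (c p) (b p) = p,
    forall m p, c (mact m p) = (m * c p)%g & forall m p, b (mact m p) = b p].
Proof.
move=> projP.
have [|p|s es sK] := projP free_mset (fun x => mact x.1 x.2).
- by move=> m x; rewrite /= mactM.
- by exists (1%g, p); rewrite mact1.
exists (fun p => (s p).1), (fun p => (s p).2).
by split=> [p|m p|m p]; rewrite ?es//; exact: sK.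
Qed.

End free_actions.

Section projective_lifting.
Context (M : monoidType) (P : mSetType M) (projP : projective P).
Context (E Z : mSpaceType M) (p : mMapType E Z).

Lemma projective_vertex_lift (f : mMapType (discrete_topology P) Z) :
  (forall x, exists e, p e = f x) ->
  exists u : mMapType (discrete_topology P) E, p \o u =1 f.
Proof.
move=> /choice [l pl]; have [c [b [cb cm bm]]] := projective_coord projP.
have cu : continuous (fun x : discrete_topology P => mact (c x) (l (b x))).
  exact: discrete_cts.
have eu : equivariant (fun x : discrete_topology P => mact (c x) (l (b x))).
  by move=> m x; rewrite -mactM -cm -[in RHS](bm m).
exists (mmap_of cu eu) => x /=.
by rewrite mmapP pl -mmapP; congr (f _); exact: cb.
Qed.

(** The lift is (x, y) |-> c(x) l_(b(x))(y). On the image of [i] this is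
    c(x) u(b(x), _) = u(x, _) as [u] is equivariant, and similarly for [p]. The
    lifts [l_x] are chosen with no compatibility. The premise [P ->] covers
    dimensions without cells. *)
Lemma projective_cell_lift (K L : topologicalType) (i : K -> L)
    (u : mMapType (discrete_topology P * trivial_mspace M K)%type E)
    (f : mMapType (discrete_topology P * trivial_mspace M L)%type Z) :
  (forall x k, p (u (x, k)) = f (x, i k)) ->
  (P -> forall (v : K -> E) (g : L -> Z), continuous v -> continuous g ->
    (forall k, p (v k) = g (i k)) ->
    exists l : L -> E, [/\ continuous l, forall k, l (i k) = v k &
      forall y, p (l y) = g y]) ->
  exists l : mMapType (discrete_topology P * trivial_mspace M L)%type E,
    (forall x k, l (x, i k) = u (x, k)) /\ p \o l =1 f.
Proof.
move=> puf lifts.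
have slice (T : topologicalType) (W : mSpaceType M)
    (w : mMapType (discrete_topology P * trivial_mspace M T)%type W) x :
    continuous (fun t : T => w (x, t)).
  have c := pair_cts (@cst_cts T (discrete_topology P) x)
    (fun t : T => @cvg_id _ (nbhs t)).
  exact: (comp_cts c (@cts_fun _ _ w)).
have /choice [l lP] (x : P) : exists l : L -> E, [/\ continuous l,
    forall k, l (i k) = u (x, k) & forall y, p (l y) = f (x, y)].
  by have := lifts x _ _ (slice K E u x) (slice L Z f x) (puf x).
have [c [b [cb cm bm]]] := projective_coord projP.
pose F (xy : discrete_topology P * trivial_mspace M L) :=
  mact (c xy.1) (l (b xy.1) xy.2).
have cF : continuous F.
  apply: discrete_prod_cts => x /=.
  by have [cl _ _] := lP (b x); exact: (comp_cts cl (@mact_cts M E (c x))).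
have eF : equivariant F.
  by move=> m [x y]; rewrite /F /= -mactM -cm -[in RHS](bm m).
exists (mmap_of cF eF); split => [x k|[x y]] /=; rewrite /F /=.
  have [_ -> _] := lP (b x); rewrite -mmapP; congr (u (_, _)); exact: cb.
have [_ _ H] := lP (b x); rewrite mmapP H -mmapP; congr (f (_, _)); exact: cb.
Qed.

End projective_lifting.

(** * Lifting over relative CW complexes *)

Section cellular_lifting.
Context (R : realType) (M : monoidType) (A X : mSpaceType M) (i : mMapType A X).
Context (C : projective_relative_CW R i) (E Z : mSpaceType M).
Context (p : mMapType E Z).

(** That the map constructed at each stage lifts [f] follows from the uniqueness
    part of the universal property of that stage. *)
Lemma relative_CW_lift (u : mMapType A E) (f : mMapType X Z) :
  (forall x : mMapType (discrete_topology (cw_cells C 0)) Z,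
    exists v : mMapType (discrete_topology (cw_cells C 0)) E, p \o v =1 x) ->
  (forall n (v : mMapType (sphere_cells R (cw_cells C n.+1) n.+1) E)
    (x : mMapType (ball_cells R (cw_cells C n.+1) n.+1) Z),
    p \o v =1 x \o @cells_boundary R M (cw_cells C n.+1) n.+1 ->
    exists l : mMapType (ball_cells R (cw_cells C n.+1) n.+1) E,
      l \o @cells_boundary R M (cw_cells C n.+1) n.+1 =1 v /\
      p \o l =1 x) ->
  p \o u =1 f \o i ->
  exists l : mMapType X E, l \o i =1 u /\ p \o l =1 f.
Proof.
move=> vertex_lift cell_lift pu.
have X0 : is_coproduct (cw_vertices C) (cw_base C) := @cw_X0 R M A X i C.
have incl : cw_skel C 0 \o cw_base C =1 i := @cw_inclusion R M A X i C.
have [colim univ] : is_sequential_colimit (cw_incl C) (cw_skel C).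
  exact: (@cw_colimit R M A X i C).
pose lifts n (w : mMapType (cw_X C n) E) := p \o w =1 f \o cw_skel C n.
have [w0 w0p w0b] : exists2 w0 : mMapType (cw_X C 0) E, lifts 0%N w0 &
    w0 \o cw_base C =1 u.
  have [v vp] := vertex_lift
    (mmap_comp (mmap_comp f (cw_skel C 0)) (cw_vertices C)).
  have [[w [wv wb]] _] := X0 E v u.
  exists w => //.
  have [_ uniq] := X0 Z (mmap_comp (mmap_comp f (cw_skel C 0)) (cw_vertices C))
    (mmap_comp (mmap_comp f (cw_skel C 0)) (cw_base C)).
  apply: (uniq (mmap_comp p w) (mmap_comp f (cw_skel C 0))) => x /=.
    by have := wv x; rewrite /= => ->; exact: vp.
  have := wb x; rewrite /= => ->.
  by have := pu x; rewrite /= => ->; rewrite -(incl x).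
have step n (w : mMapType (cw_X C n) E) : lifts n w ->
    {w' : mMapType (cw_X C n.+1) E | lifts n.+1 w' /\ w' \o cw_incl C n =1 w}.
  move=> pw; apply: cid.
  pose F := mmap_comp f (cw_skel C n.+1).
  have [square po] : is_pushout (cw_attach C n)
      (@cells_boundary R M (cw_cells C n.+1) n.+1) (cw_incl C n) (cw_char C n).
    exact: (@cw_XS R M A X i C n).
  have [|l [lb lp]] := cell_lift n (mmap_comp w (cw_attach C n))
      (mmap_comp F (cw_char C n)).
    move=> x /=; have := pw (cw_attach C n x); rewrite /= => ->.
    by have := square x; rewrite /= => <-; rewrite -(colim n).
  have [|[w' [w'i w'c]] _] := po E w l; first by move=> x; rewrite lb.
  exists w'; split=> //.
  have [|_ uniq] := po Z (mmap_comp F (cw_incl C n))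
      (mmap_comp F (cw_char C n)).
    by move=> x; have := square x; rewrite /= => ->.
  apply: (uniq (mmap_comp p w') F) => x /=.
    have := w'i x; rewrite /= => ->; have := pw x; rewrite /= => ->.
    by rewrite -(colim n).
  by have := w'c x; rewrite /= => ->; exact: lp.
pose w := fix w n : {w : mMapType (cw_X C n) E | lifts n w} :=
  if n is n'.+1 then
    let s := step n' (sval (w n')) (svalP (w n')) in
    exist _ (sval s) (proj1 (svalP s))
  else exist _ w0 w0p.
have wS n : sval (w n.+1) \o cw_incl C n =1 sval (w n).
  exact: (proj2 (svalP (step n (sval (w n)) (svalP (w n))))).
have [[l lw] _] := univ E (fun n => sval (w n)) wS.
exists l; split=> [a|].
  rewrite /= -(incl a) /=.
  by have := lw 0%N (cw_base C a); rewrite /= => ->; exact: w0b.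
have [|_ uniq] := univ Z (fun n => mmap_comp f (cw_skel C n)).
  by move=> n x /=; rewrite -(colim n).
apply: (uniq (mmap_comp p l) f) => n x /=.
by have := lw n x; rewrite /= => ->; exact: (svalP (w n)).
Qed.

End cellular_lifting.

(** * The mapping path space as an M-space *)

Section path_mspace.
Context (R : realType) (M : monoidType) (Y Z : mSpaceType M) (k : mMapType Y Z).
Local Notation I := (unitI R).

Definition path_mspace : Type := path_space R k.

HB.instance Definition _ := Topological.on path_mspace.

Lemma path_act_subproof (m : M) (e : path_mspace) :
  (mact m (path_base e), (fun t => mact m (path_at e t)) :
    {compact-open, I -> Z}) \in path_pairs R k.
Proof.
have [ce e1] := path_spaceP e.
rewrite inE; split; first exact: comp_cts ce (@mact_cts M Z m).
by rewrite /= e1 mmapP.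
Qed.

Definition path_act (m : M) (e : path_mspace) : path_mspace :=
  exist _ (mact m (path_base e), (fun t => mact m (path_at e t)) :
    {compact-open, I -> Z}) (path_act_subproof m e).

Lemma path_act1 e : path_act 1%g e = e.
Proof. by apply: path_space_eq => [|t]; exact: mact1. Qed.

Lemma path_actM m n e : path_act (m * n)%g e = path_act m (path_act n e).
Proof. by apply: path_space_eq => [|t]; exact: mactM. Qed.

HB.instance Definition _ := isMSet.Build M path_mspace path_act1 path_actM.

Lemma path_act_continuous : continuous
  (fun me : discrete_topology M * path_mspace => mact (me.1 : M) me.2).
Proof.
apply: path_space_cts => /=.
  have c2 := comp_cts (@snd_cts (discrete_topology M) path_mspace)
    (@path_base_cts R Y Z k).
  exact: comp_cts (pair_cts (@fst_cts _ _) c2) (@mact_continuous M Y).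
pose T := ((discrete_topology M * path_mspace) * I)%type.
have c1 : continuous (fun x : T => x.1.1).
  exact: comp_cts (@fst_cts _ _) (@fst_cts _ _).
have c2 : continuous (fun x : T => path_at x.1.2 x.2).
  apply: path_at_comp_cts; last exact: snd_cts.
  exact: comp_cts (@fst_cts _ _) (@snd_cts _ _).
exact: comp_cts (pair_cts c1 c2) (@mact_continuous M Z).
Qed.

HB.instance Definition _ := isMSpace.Build M path_mspace path_act_continuous.

Lemma path_base_act m (e : path_mspace) :
  path_base (mact m e) = mact m (path_base e).
Proof. by []. Qed.

Lemma path_at_act m (e : path_mspace) t :
  path_at (mact m e) t = mact m (path_at e t).
Proof. by []. Qed.

Definition path_base_mmap : mMapType path_mspace Y :=
  @mmap_of M path_mspace Y _ (@path_base_cts R Y Z k) (fun _ _ => erefl).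

Definition path_start_mmap : mMapType path_mspace Z :=
  @mmap_of M path_mspace Z _ (@path_start_cts R Y Z k) (fun _ _ => erefl).

Definition path_at_mmap : mMapType (cylinder R path_mspace) Z :=
  @mmap_of M (cylinder R path_mspace) Z _ (@path_at_cts R Y Z k)
    (fun _ _ => erefl).

Lemma path_mspace_mmap (A : mSpaceType M) (g : mMapType A Y)
    (h : mMapType (cylinder R A) Z) : k \o g =1 h \o cyl_in1 R ->
  exists e : mMapType A path_mspace, (forall a, path_base (e a) = g a) /\
    (forall a t, path_at (e a) t = h (a, t)).
Proof.
move=> kg.
have [e [ce eb ep]] : {e : A -> path_mspace | [/\ continuous e,
    forall a, path_base (e a) = g a &
    forall a t, path_at (e a) t = h (a, t)]}.
  exact: (into_path_space (@cts_fun _ _ g) (@cts_fun _ _ h)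
    (fun a => esym (kg a))).
have ee : equivariant e.
  move=> m a; apply: path_space_eq => [|t].
    by rewrite path_base_act !eb mmapP.
  by rewrite path_at_act !ep -mmapP.
by exists (mmap_of ce ee).
Qed.

Lemma path_start_surjective : pi_surjective R k 0 ->
  forall z : Z, exists e : path_mspace, path_start e = z.
Proof.
move=> k0 z; have [c] := k0 (pi0_class R z).
rewrite /pi0_map => /pi0_classP [g [cg g0 g1]].
set y := repr _ in g0.
pose r t := g (clamp (-1 * \val (t : I) + 1)).
have cr : continuous r.
  apply: (comp_cts _ cg); apply: (comp_cts _ (@clamp_continuous R)).
  apply: add_cts; last exact: cst_cts.
  by apply: mul_cts; [exact: cst_cts|exact: val_cts].
have P : (y, r : {compact-open, I -> Z}) \in path_pairs R k.
  by rewrite inE; split => //=; rewrite /r clamp0//= mulr1 addNr.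
exists (exist _ (y, r : {compact-open, I -> Z}) P).
rewrite -g1 -[LHS]/(r (unitI0 R)) /r clamp1//=.
by rewrite mulr0 add0r.
Qed.

End path_mspace.

(** * n-equivalences and the theorem *)

Section equivalences.
Context (R : realType) (Y Z : topologicalType) (k : continuousType Y Z).

Lemma pi_bijective_surj q : pi_bijective R k q -> pi_surjective R k q.
Proof.
case: q => [[k' _ kK] z|q kq y z]; first by exists (k' z); exact: kK.
by have [k' _ kK] := kq y; exists (k' z); exact: kK.
Qed.

Definition leq_dim (q : nat) (n : option nat) : bool :=
  if n is Some m then (q <= m)%N else true.

Lemma n_equivalence_surj n q : n_equivalence R n k ->
  leq_dim q n -> pi_surjective R k q.
Proof.
case: n => [m [kb ks]|kb _]; last exact: pi_bijective_surj.
by rewrite /= leq_eqVlt => /orP[/eqP ->//|/kb/pi_bijective_surj].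
Qed.

Lemma n_equivalence_bij n q : n_equivalence R n k ->
  leq_dim q.+1 n -> pi_bijective R k q.
Proof. by case: n => [m [kb _] /kb|kb _]. Qed.

End equivalences.

Theorem theorem2p5 (R : realType) (M : monoidType) (n : option nat)
    (X A : mSpaceType M) (i : mMapType A X)
    (C : projective_relative_CW R i) (hC : dim_le C n)
    (Y Z : mSpaceType M) (k : mMapType Y Z) (hk : n_equivalence R n k)
    (f : mMapType X Z) (g : mMapType A Y) (h : mMapType (cylinder R A) Z)
    (hgh : k \o g =1 h \o cyl_in1 R)
    (hfh : f \o i =1 h \o cyl_in0 R) :
  exists (g' : mMapType X Y) (h' : mMapType (cylinder R X) Z),
    [/\ g' \o i =1 g,
        h' \o cylinder_map R i =1 h,
        h' \o cyl_in0 R =1 f &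
        h' \o cyl_in1 R =1 k \o g'].
Proof.
have [e [eb ep]] := path_mspace_mmap hgh.
have [|||l [le lf]] := @relative_CW_lift R M A X i C
    (path_mspace R k) Z (path_start_mmap R k) e f.
- move=> x; apply: projective_vertex_lift; first exact: cw_projective.
  move=> c; apply: path_start_surjective.
  by apply: (n_equivalence_surj hk); case: (n).
- move=> q u c uc.
  have [x y|x v b|l [lb lc]] := projective_cell_lift
      (@cw_projective R M A X i C q.+1)
      (p := path_start_mmap R k) (i := @sphere_ball R q.+1) (u := u) (f := c).
  + exact: uc (x, y).
  + have qn : leq_dim q.+1 n.
      (* the cell [x] excludes the dimensions above [n] *)
      case: (n) hC => //= m dm; rewrite ltnNge; apply/negP => mq.
      by have : [set: cw_cells C q.+1] x by []; rewrite dm.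
    move=> cv cb pv.
    exact: (ball_lift (n_equivalence_bij hk qn) (n_equivalence_surj hk qn)
      cb cv pv).
  + by exists l; split => // -[x y]; exact: lb.
- by move=> a; have := hfh a; rewrite /= => ->; exact: ep.
exists (mmap_comp (path_base_mmap R k) l).
have cl : continuous (cylinder_map R l).
  apply: pair_cts; last exact: snd_cts.
  exact: comp_cts (@fst_cts _ _) (@cts_fun _ _ l).
have el : equivariant (cylinder_map R l).
  by move=> m [x t]; rewrite /cylinder_map /= mmapP.
exists (mmap_comp (path_at_mmap R k) (mmap_of cl el)); split.
- by move=> a; rewrite /= -eb -le.
- by move=> [a t]; rewrite -ep -le.
- by move=> x; exact: lf.
- by move=> x; exact: (proj2 (path_spaceP (l x))).
Qed.
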